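(* Let $F_0,F_1,\dotsc$ be the frog dynamics associated with an irreducible word $W\in\Sigma^k$. Then: (i) the chain has a unique stationary distribution; (ii) the average speed of frog $f_m$ (for each $m\in\{1,\dots,k\}$), which is defined as the limit $$s_m=\lim_{n\to\infty}\frac{\mathbb{E}_{R\sim\Sigma^n}D_m(F_0,R)}{n},$$ exists and is independent of the initial state $F_0$; (iii) for every $\rho\ge 0$, the constant $\gamma_W=\gamma_W(\rho)$ can be expressed as $$\gamma_W=\rho-\frac1k\sum_{m:\ s_m\le\rho}(\rho-s_m),$$ and the constant $\tau_W=\tau_W(\rho)$ is nonzero if and only if $\rho=s_m$ for some $m$. Here $\gamma_W(\rho)$ and $\tau_W(\rho)$ are the constants for which $\mathbb{E}_{R\sim\Sigma^n}\mathrm{LCS}(R,W^{(\rho n)})=\gamma_W(\rho)\,n-\tau_W(\rho)\sqrt n+O(1)$ as $n\to\infty$.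
   Context: Words: a word is a finite sequence of symbols from a finite alphabet $\Sigma$, indexed from $0$; $R\sim\Sigma^n$ means $R$ is uniformly random in $\Sigma^n$. $\mathrm{LCS}(V,V')$ is the length of the longest common (not necessarily contiguous) subsequence of $V$ and $V'$. For a word $W$ of length $k$, $W^{(n)}$ is the word of length $n$ with $i$-th symbol $W_{i\bmod k}$; for non-integer $x\geq 0$ read $W^{(x)}$ as $W^{(\lfloor x\rfloor)}$. A word $W\in\Sigma^k$ is reducible if $W=U^{(k)}$ for some $U\in\Sigma^\ell$ with $\ell<k$ and $\ell\mid k$; otherwise it is irreducible. Frog dynamics: let $W=W_0\cdots W_{k-1}\in\Sigma^k$. There are $k$ lily pads indexed by $\mathbb{Z}/k\mathbb{Z}$, pad $i$ being labeled $W_i$, and $k$ frogs $f_1,\dots,f_k$, where $f_i$ is nastier than $f_j$ iff $i<j$. A frog arrangement is a bijection $F:\{f_1,\dots,f_k\}\to\mathbb{Z}/k\mathbb{Z}$. For a symbol $c\in\Sigma$, the arrangement $Fc$ is obtained as follows. Initially, the agitated frogs are exactly those sitting on pads labeled $c$. As long as some frog is agitated, let $f_m$ be the nastiest agitated frog, currently on pad $x$; it leaves $x$ and leaps to pad $x+y$, where $y\in\{1,\dots,k\}$ is the least integer such that pad $x+y$ is not currently occupied by a frog nastier than $f_m$; then $f_m$ calms down and any other frog currently on pad $x+y$ becomes agitated. (Each frog moves at most once.) The final positions form the arrangement $Fc$. Put $D_m(F,c)=y$ if $f_m$ leapt (by $y$) during this process and $D_m(F,c)=0$ otherwise. For a word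 $R=R_0\cdots R_{\ell-1}$, $FR=(\cdots((FR_0)R_1)\cdots)R_{\ell-1}$, and $D_m(F,R)=\sum_{t=0}^{\ell-1}D_m(FR_0\cdots R_{t-1},R_t)$ is the total displacement of $f_m$. The frog dynamics associated with $W$ is the Markov chain $F_{i+1}=F_iR_i$, where $R_0,R_1,\dots$ are independent uniformly random symbols of $\Sigma$ and $F_0$ is any initial arrangement.
   Formalization: The criterion that τ_W is nonzero iff ρ = s_m for some m is stated only for alphabets with at least two letters; over a one-letter alphabet (W = a, k = 1, s_1 = 1) τ_W(1) = 0, so the criterion fails there. *)

(* Defs.v *)
From mathcomp Require Import all_boot all_order all_algebra all_fingroup.

Set Implicit Arguments.
Unset Strict Implicit.
Unset Printing Implicit Defensive.

Section Words.
Variable Sigma : eqType.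
Implicit Types U V W : seq Sigma.

(* [mask b V] runs over all subsequences of [V]. *)
Definition lcs V V' : nat :=
  \max_(b : (size V).-tuple bool | subseq (mask b V) V') size (mask b V).

(* The word W^(n); the case split only serves to provide a default letter
   for [nth], and the value for the empty [W] is a dummy. *)
Definition periodic_word W (n : nat) : seq Sigma :=
  if W is w :: _ then mkseq (fun i => nth w W (i %% size W)) n else [::].

Definition reducible_word W : Prop :=
  exists U, [/\ (size U < size W)%N, (size U %| size W)%N
              & W = periodic_word U (size W)].

End Words.

Section Frogs.
Variables (Sigma : finType) (k : nat).

(* Frogs and lily pads are both indexed by ['I_k]: frog [m] is the frog
   f_(m+1), nastier than frog [j] iff [m < j], and pads are taken modulo k.
   A bijection from frogs to pads is thus a permutation of ['I_k]. *)
Definition arrangement := 'S_k.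

Definition pad_shift (x : 'I_k) (y : nat) : 'I_k := iter y (@ordS k) x.

(* A snapshot in the middle of a step; two frogs may then share a pad.
   [leap m] is the length of the leap already made by frog [m], 0 if none. *)
Record snapshot := Snapshot {
  pos : {ffun 'I_k -> 'I_k};
  agitated : {set 'I_k};
  leap : {ffun 'I_k -> nat} }.

(* Least y >= 1 such that no frog nastier than [m] is on pad [x + y]; it is at
   most k because fewer than k frogs are nastier than [m]. *)
Definition leap_length (p : {ffun 'I_k -> 'I_k}) (m : 'I_k) : nat :=
  (find (fun y => [forall j : 'I_k, (j < m)%N ==> (p j != pad_shift (p m) y)])
        (iota 1 k)).+1.

Definition leap_once (s : snapshot) : snapshot :=
  if [pick m in agitated s | [forall j in agitated s, (m <= j)%N]] is Some m
  then
    let y := leap_length (pos s) m in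
    let x' := pad_shift (pos s m) y in
    Snapshot [ffun j => if j == m then x' else pos s j]
             ((agitated s :\ m) :|: [set j | (j != m) && (pos s j == x')])
             [ffun j => if j == m then y else leap s j]
  else s.

Variable W : k.-tuple Sigma.

Definition poke (F : arrangement) (c : Sigma) : snapshot :=
  Snapshot [ffun j => F j] [set j | tnth W (F j) == c] [ffun=> 0%N].

(* Each frog leaps at most once, so that k iterations exhaust the process:
   see [settle_calm]. *)
Definition settle (F : arrangement) (c : Sigma) : snapshot :=
  iter k leap_once (poke F c).

Lemma pad_shiftE (x : 'I_k) (y : nat) : (pad_shift x y = (x + y) %% k :> nat)%N.
Proof.
elim: y => [|y IHy]; first by rewrite addn0 modn_small.
by rewrite /pad_shift iterS -/(pad_shift x y) /= IHy -addn1 modnDml addn1 addnS.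
Qed.

Lemma leap_lengthP (p : {ffun 'I_k -> 'I_k}) (m j : 'I_k) :
  (j < m)%N -> p j != pad_shift (p m) (leap_length p m).
Proof.
pose P y := [forall j : 'I_k, (j < m)%N ==> (p j != pad_shift (p m) y)].
have hasP : has P (iota 1 k).
  apply/negPn/negP => /hasPn noP.
  pose A := [set j : 'I_k | (j < m)%N].
  have all_pads (x : 'I_k) : x \in p @: A.
    pose y := (k - (p m) + x)%N.
    have [y' y'_in x_def] : exists2 y', y' \in iota 1 k & x = pad_shift (p m) y'.
      have k0 : (0 < k)%N by apply: leq_ltn_trans (ltn_ord x).
      have xE y' : (y' = y %[mod k])%N -> x = pad_shift (p m) y'.
        move=> y'E; apply: val_inj; rewrite /= pad_shiftE -modnDmr y'E modnDmr.
        by rewrite /y addnA subnKC ?(ltnW (ltn_ord _)) // modnDl modn_small.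
      case: (posnP (y %% k)) => [y0|ypos].
        exists k; first by rewrite mem_iota k0 add1n ltnS leqnn.
        by apply: xE; rewrite modnn y0.
      exists (y %% k)%N; last by apply: xE; rewrite modn_mod.
      by rewrite mem_iota ypos add1n ltnS ltnW // ltn_pmod.
    have /forallPn[j0] := noP _ y'_in; rewrite negb_imply negbK.
    by case/andP=> j0m /eqP jE; apply/imsetP; exists j0; rewrite ?inE // x_def.
  have := leq_imset_card p (mem A).
  have -> : #|p @: A| = k.
    by rewrite -[RHS]card_ord; apply: eq_card => x; rewrite all_pads.
  apply/negP; rewrite -ltnNge -[X in (_ < X)%N]card_ord -cardsT.
  apply: proper_card; rewrite properE subsetT; apply/subsetPn.
  by exists m; rewrite !inE ?ltnn.
move=> jm; have := nth_find 0%N hasP; rewrite nth_iota; last first.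
  by rewrite has_find size_iota in hasP.
by rewrite add1n => /forallP/(_ j); rewrite jm.
Qed.

Lemma leap_once_pos_inj (s : snapshot) :
  (forall i j, i != j -> pos s i = pos s j ->
     (i \in agitated s) || (j \in agitated s)) ->
  forall i j, i != j -> pos (leap_once s) i = pos (leap_once s) j ->
     (i \in agitated (leap_once s)) || (j \in agitated (leap_once s)).
Proof.
move=> inj_s; rewrite /leap_once; case: pickP => [m _|_] //= i j ij.
rewrite !ffunE !inE; case: (eqVneq i m) => [im|im]; case: (eqVneq j m) => [jm|jm] /=.
- by rewrite im jm eqxx in ij.
- by move=> <-; rewrite eqxx orbT.
- by move=> ->; rewrite eqxx !orbT.
by move=> /(inj_s _ _ ij)/orP[->|->]; rewrite ?orbT.
Qed.

Lemma leap_once_agitated (s : snapshot) (t : nat) :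
  (forall j, j \in agitated s -> (t <= j)%N) ->
  forall j, j \in agitated (leap_once s) -> (t < j)%N.
Proof.
move=> ge_t; rewrite /leap_once; case: pickP => [m /andP[mA /forall_inP mmin]|none] j.
  have tm := ge_t _ mA; rewrite /= !inE => /orP[/andP[jm jA]|/andP[jm /eqP pj]].
    by apply: leq_ltn_trans tm _; rewrite ltn_neqAle eq_sym jm mmin.
  apply: leq_ltn_trans tm _; rewrite ltnNge leq_eqVlt negb_or jm /=.
  by apply/negP => /(leap_lengthP (pos s)); rewrite pj eqxx.
move=> jA; case: (@arg_minnP _ j [in agitated s] val jA) => i iA imin.
by have := none i; rewrite /= iA /= => /negP[]; apply/forall_inP => l /imin.
Qed.

Lemma settle_calm (F : arrangement) (c : Sigma) : agitated (settle F c) = set0.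
Proof.
have ge_t t j : j \in agitated (iter t leap_once (poke F c)) -> (t <= j)%N.
  elim: t j => // t IHt j; rewrite iterS; exact: leap_once_agitated.
apply/setP => j; rewrite inE; apply/negP => /ge_t.
by rewrite leqNgt ltn_ord.
Qed.

Lemma settle_inj (F : arrangement) (c : Sigma) : injective (pos (settle F c)).
Proof.
have inj_t t i j : i != j ->
    let s := iter t leap_once (poke F c) in
    pos s i = pos s j -> (i \in agitated s) || (j \in agitated s).
  elim: t i j => [|t IHt] i j ij; last exact: leap_once_pos_inj ij.
  by rewrite /= !ffunE => /perm_inj /eqP; rewrite (negPf ij).
move=> i j eq_ij; apply/eqP/negPn/negP => /(inj_t k)/(_ eq_ij).
by rewrite -/(settle F c) settle_calm !inE.
Qed.

(* The arrangement F c. *)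
Definition frog_move (F : arrangement) (c : Sigma) : arrangement :=
  perm (@settle_inj F c).

(* D_m(F, c) *)
Definition displacement1 (F : arrangement) (c : Sigma) (m : 'I_k) : nat :=
  leap (settle F c) m.

(* D_m(F, r) *)
Definition displacement (F : arrangement) (n : nat) (r : n.-tuple Sigma)
    (m : 'I_k) : nat :=
  \sum_(t < n) displacement1 (foldl frog_move F (take t r)) (tnth r t) m.

End Frogs.

Arguments arrangement : clear implicits.

From mathcomp Require Import all_classical all_reals all_analysis.

Import Order.TTheory GRing.Theory Num.Theory.
Import numFieldNormedType.Exports.

Local Open Scope classical_set_scope.
Local Open Scope ring_scope.

Section Probability.
Variable R : realType.

(* Expectation of [f x] for x uniformly random in [T]. *)
Definition expect (T : finType) (f : T -> R) : R := (\sum_x f x) / #|T|%:R.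

Variables (Sigma : finType) (k : nat) (W : k.-tuple Sigma).

Definition frog_transition (F G : arrangement k) : R :=
  expect (fun c : Sigma => (frog_move W F c == G)%:R).

Definition frog_stationary (pi : {ffun arrangement k -> R}) : Prop :=
  [/\ forall F, 0 <= pi F,
      \sum_F pi F = 1
    & forall G, \sum_F pi F * frog_transition F G = pi G].

Definition expected_displacement (F : arrangement k) (m : 'I_k) (n : nat) : R :=
  expect (fun r : n.-tuple Sigma => (displacement W F r m)%:R).

(* [Num.truncn x] is the floor of x for x >= 0. *)
Definition expected_lcs (rho : R) (n : nat) : R :=
  expect (fun r : n.-tuple Sigma =>
    (lcs r (periodic_word W (Num.truncn (rho * n%:R))))%:R).

(* gamma = gamma_W(rho) and tau = tau_W(rho):
   E LCS(r, W^(rho n)) = gamma n - tau sqrt n + O(1) as n -> oo. *)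
Definition lcs_constants (rho gamma tau : R) : Prop :=
  exists C : R, \forall n \near \oo,
    `|expected_lcs rho n - (gamma * n%:R - tau * Num.sqrt n%:R)| <= C.

End Probability.

(* Main.v *)
(**
Start the frogs with [f_m] on pad [m] and let [X_m(t)] be [m] plus its
displacement. The positions where [LCS(R, W^(n))], as a function of [n], does
not increase form the trails [X_m, X_m + k, X_m + 2k, ...]: reading a letter
moves them as it moves the frogs. Hence
[LCS(R, W^(n)) = n - sum_m (n - X_m)^+ / k + O(1)].

If [W] is irreducible, reading [W] long enough brings all arrangements to the
same one: once the first [m] frogs follow the reading head, the gap between the
head and the next frog decreases at each mismatch of [W] with its shift by the
gap. Thus the stationary law is unique, Poisson's equation is solvable, and
[D_m = s_m n + A_n + O(1)] with [A_n] a martingale driven by the chain. For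
[rho <> s_m], Chebyshev's inequality gives
[E (rho n - D_m)^+ = (rho - s_m)^+ n + O(1)]. For [rho = s_m] one needs
[E |A_n| = a sqrt n + O(1)]: Stein's equation for [|x|] reduces it to
[E (A_n f(A_n) - sigma^2 n f'(A_n)) = O(1)], where [f''] is [O(1/n)], and this
holds because synchronization makes the law of the future increments nearly
independent of the present state.

Finally [a = 0] would force all cycles of the chain to have speed [s_m]. Reading
[W] gives speed 1, whereas on a cycle read off a constant word a frog either
rests or runs faster than 1, so [a > 0] when there are two letters.
*)
Require Import Defs.
From HB Require Import structures.
From mathcomp Require Import all_boot all_order all_algebra all_fingroup.
From mathcomp Require Import all_classical all_reals all_analysis.
From mathcomp Require Import zify ring lra.

Set Implicit Arguments.
Unset Strict Implicit.
Unset Printing Implicit Defensive.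

(** * Longest common subsequences *)

Section LcsRecursion.
Variable Sigma : eqType.
Implicit Types u v s : seq Sigma.

(** A central limit theorem would not give an error [O(1)]: after normalization, the estimate for
    [E |A_n|] is a rate of convergence [O(1 / sqrt n)]. So each of the [n] increments may cost only
    [O(1/n)], the size of [f''] after scaling; paying [sup |f'|], of order [1 / sqrt n], whenever
    the state changes would be too much. Two states are therefore compared by driving both chains
    with the same letters. The expected number of times at which they differ is bounded uniformly in
    the horizon, and since the increments are centred each such time costs only [O(f'')]. The second
    derivative of the Stein solution for [|x|] jumps at the origin, so the test functions are
    controlled only by a Lipschitz bound on [f'] and the matching Taylor bound.

    On the combinatorial side a leap is not a local move. It is replaced by a rule at each pad,
    relating the occupants before and after the step to the frogs crossing the two adjacent edges.
    When only the [t] nastiest frogs are distinguished these data are bits, and the rule becomes the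
    recursion for the increments of the LCS. *)

Lemma leq_lcs u v s : subseq s u -> subseq s v -> size s <= lcs u v.
Proof.
case/subseqP => b sb -> sv; have sbT : size b == size u by rewrite sb.
exact: (@leq_bigmax_cond _ (fun b : (size u).-tuple bool => subseq (mask b u) v)
  (fun b => size (mask b u)) (Tuple sbT) sv).
Qed.

Lemma lcs_witness u v :
  exists s, [/\ subseq s u, subseq s v & size s = lcs u v].
Proof.
pose A := [pred b : (size u).-tuple bool | subseq (mask b u) v].
have A0 : 0 < #|A|.
  apply/card_gt0P; exists (nseq_tuple (size u) false).
  by rewrite inE /= mask_false sub0seq.
have [b bA Emax] := eq_bigmax_cond (fun b : (size u).-tuple bool => size (mask b u)) A0.
by exists (mask b u); split => //; apply: mask_subseq.
Qed.

(** [subseq] matches from the head; reversing both words turns the last letters into heads. *)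
Lemma subseq_rcons2 s x u a :
  subseq (rcons s x) (rcons u a) =
  if x == a then subseq s u else subseq (rcons s x) u.
Proof.
rewrite -subseq_rev !rev_rcons /=.
by case: eqP => _; rewrite -?rev_rcons subseq_rev.
Qed.

Lemma lcs0s v : lcs [::] v = 0.
Proof.
have [s [+ _ <-]] := lcs_witness [::] v.
by rewrite subseq0 => /eqP->.
Qed.

Lemma lcss0 u : lcs u [::] = 0.
Proof.
have [s [_ + <-]] := lcs_witness u [::].
by rewrite subseq0 => /eqP->.
Qed.

Lemma lcs_rcons u a v b :
  lcs (rcons u a) (rcons v b) =
  maxn (maxn (lcs (rcons u a) v) (lcs u (rcons v b)))
       ((a == b) * (lcs u v).+1).
Proof.
apply/eqP; rewrite eqn_leq; apply/andP; split; last first.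
  rewrite !geq_max -andbA; apply/and3P; split.
  - have [s [su sv <-]] := lcs_witness (rcons u a) v.
    by apply: leq_lcs => //; apply: subseq_trans sv (subseq_rcons _ _).
  - have [s [su sv <-]] := lcs_witness u (rcons v b).
    by apply: leq_lcs => //; apply: subseq_trans su (subseq_rcons _ _).
  - case: eqP => [<-|_] //; rewrite mul1n.
    have [s [su sv <-]] := lcs_witness u v.
    by rewrite -(size_rcons s a); apply: leq_lcs; rewrite subseq_rcons2 eqxx.
have [s [su sv <-]] := lcs_witness (rcons u a) (rcons v b).
move: su sv; case/lastP: s => [|s x] //.
rewrite !subseq_rcons2 !leq_max size_rcons.
case: (eqVneq x a) => [<-|xa] su; case: (eqVneq x b) => [<-|xb] sv.
- by rewrite mul1n ltnS leq_lcs ?orbT.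
- by rewrite -(size_rcons s x) leq_lcs // subseq_rcons2 eqxx.
- by rewrite -(size_rcons s x) (@leq_lcs u) ?orbT // subseq_rcons2 eqxx.
- by rewrite -(size_rcons s x) leq_lcs // subseq_rcons2 (negPf xa).
Qed.

End LcsRecursion.

(** * One step of the frog dynamics *)

Section FrogStep.
Variables (Sigma : finType) (k : nat) (W : k.-tuple Sigma).
Implicit Types (F : arrangement k) (c : Sigma).

(** If the search over [1, ..., k] failed, [leap_length] would be [k + 1]. By [leap_lengthP] that
    pad carries no nastier frog; but it is the pad of [y = 1], where the search would have
    stopped. *)
Lemma leap_length_le (p : {ffun 'I_k -> 'I_k}) (m : 'I_k) :
  leap_length p m <= k.
Proof.
have k0 : 0 < k by apply: leq_ltn_trans (ltn_ord m).
pose P y := [forall j : 'I_k, (j < m) ==> (p j != pad_shift (p m) y)].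
rewrite /leap_length -/P -[X in _ < X](size_iota 1 k) -has_find.
apply/negPn/negP => noP; have := noP => /hasPn /(_ 1).
have -> : 1 \in iota 1 k by rewrite mem_iota; lia.
move=> /(_ isT) /negP; apply.
apply/forallP => j; apply/implyP => /(leap_lengthP p).
rewrite /leap_length -/P hasNfind // size_iota; apply: contra => /eqP->.
by apply/eqP/ord_inj; rewrite pad_shiftE [RHS]pad_shiftE -[k.+1]addn1 addnA addnAC modnDr.
Qed.

Lemma leap_length_before (p : {ffun 'I_k -> 'I_k}) (m : 'I_k) i :
  0 < i < leap_length p m ->
  exists2 j : 'I_k, j < m & p j = pad_shift (p m) i.
Proof.
case: i => // i /andP[_ iy].
have ik : i < k by apply: ltnW (leq_trans iy (leap_length_le p m)).
have := before_find 0 iy; rewrite nth_iota // add1n.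
move=> /negbT /forallPn[j]; rewrite negb_imply negbK => /andP[jm /eqP pj].
by exists j.
Qed.

(** Agitated frogs leap in order of nastiness, so a frog that has leapt is never disturbed again and
    the nastier frogs under its leap stay put; thus [inv_over] survives to the end. Once no frog is
    agitated, [inv_agitated] tells which frogs leapt in terms of the initial and final arrangements
    alone. *)
Record leap_invariant F c (s : snapshot k) : Prop := LeapInvariant {
  inv_pos : forall m, pos s m = pad_shift (F m) (leap s m);
  inv_leap : forall m, leap s m <= k;
  inv_over : forall m i, 0 < i < leap s m ->
    exists2 j : 'I_k, j < m & pos s j = pad_shift (F m) i;
  inv_agitated : forall m, (m \in agitated s) || (0 < leap s m) =
    (tnth W (F m) == c) || [exists j : 'I_k, (j < m) && (pos s j == F m)];
  inv_fresh : forall m, m \in agitated s -> leap s m = 0;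
  inv_order : forall m j, m \in agitated s -> 0 < leap s j -> j < m }.

Lemma leap_invariant_once F c (s : snapshot k) :
  leap_invariant F c s -> leap_invariant F c (leap_once s).
Proof.
case=> Ipos Ileap Iover Iag Ifresh Iord; rewrite /leap_once.
case: pickP => [m /andP[mA /forall_inP mmin]|_] //.
set y := leap_length _ _; set x' := pad_shift _ _.
have posm : pos s m = F m by rewrite Ipos Ifresh.
have y0 : 0 < y by [].
have far (j : 'I_k) : j < m -> pos s j != x' by apply: leap_lengthP.
(* Landing disturbs only less nasty frogs, since no nastier one is on [x']. *)
have new (a : 'I_k) : (a \in agitated s :\ m :|: [set j | (j != m) && (pos s j == x')]) -> m < a.
  rewrite !inE ltn_neqAle eq_sym => /orP[/andP[am aA]|/andP[am ax]].
    by rewrite am mmin.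
  by rewrite am /= leqNgt; apply: contraL ax; apply: far.
have later (a : 'I_k) : m < a -> leap s a = 0.
  move=> ma; apply/eqP; rewrite -leqn0 leqNgt; apply: contraL ma.
  by move=> /(Iord _ _ mA); rewrite -leqNgt; apply: ltnW.
split=> /=.
- by move=> j; rewrite !ffunE; case: eqP => [->|_] //; rewrite /x' posm.
- by move=> j; rewrite ffunE; case: eqP => _ //; apply: leap_length_le.
- move=> j i; rewrite ffunE; case: eqP => [->|/eqP jm] iy.
    have [j' j'm pj'] := leap_length_before iy.
    by exists j' => //; rewrite ffunE -posm -pj' ifN // neq_ltn j'm.
  have [j' j'j pj'] := Iover _ _ iy; exists j' => //.
  have jm' : j < m by apply: Iord mA _; case/andP: iy; case: (leap s j).
  by rewrite ffunE ifN // neq_ltn (ltn_trans j'j).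
- move=> a; rewrite !inE ffunE.
  case: (ltngtP a m) => [am|ma|/val_inj am].
  + have aNm : a != m by rewrite neq_ltn am.
    rewrite (negPf aNm) /= (negPf (far _ am)) orbF Iag; congr (_ || _).
    apply: eq_existsb => j; rewrite ffunE; case: (eqVneq j m) => [->|//].
    by rewrite ltnNge (ltnW am).
  + have aNm : a != m by rewrite neq_ltn ma orbT.
    have := Iag a; rewrite (negPf aNm) (later _ ma) /= !orbF => ->.
    rewrite Ipos later //= -orbA; congr (_ || _).
    (* Frog [a] is still on [F a], so it becomes agitated when [m] lands there; the pad that [m]
       leaves is not [F a] because [F] is injective. *)
    apply/orP/existsP => [[/existsP[j /andP[ja jF]]|Fax']|[j]].
    * exists j; rewrite ja ffunE ifN //; apply: contraTN jF => /eqP->.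
      by rewrite posm (inj_eq perm_inj) eq_sym.
    * by exists m; rewrite ma ffunE eqxx eq_sym.
    * rewrite ffunE => /andP[ja]; case: (eqVneq j m) => [_|_ jF]; first by right; rewrite eq_sym.
      by left; apply/existsP; exists j; rewrite ja.
  + subst a; rewrite eqxx y0 /=; have := Iag m; rewrite mA /= => ->.
    congr (_ || _); apply: eq_existsb => j; rewrite ffunE; case: (eqVneq j m) => [->|//].
    by rewrite ltnn.
- by move=> a /new ma; rewrite ffunE ifN ?later // neq_ltn ma orbT.
- move=> a j /new ma; rewrite ffunE; case: eqP => [->|_] // /(Iord _ _ mA) jm.
  exact: ltn_trans jm ma.
Qed.

Lemma leap_invariant_settle F c : leap_invariant F c (settle W F c).
Proof.
suff inv_iter i : leap_invariant F c (iter i (@leap_once k) (poke W F c)) by exact: inv_iter.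
elim: i => [|i IHi]; last exact: leap_invariant_once.
split=> /=.
- by move=> m; rewrite !ffunE.
- by move=> m; rewrite ffunE.
- by move=> m i; rewrite ffunE ltn0 andbF.
- move=> m; rewrite inE ffunE orbF; case: existsP => [[j /andP[jm]]|_]; last by rewrite orbF.
  by rewrite ffunE (inj_eq perm_inj) => /eqP jE; rewrite jE ltnn in jm.
- by move=> m; rewrite ffunE.
- by move=> m j _; rewrite ffunE.
Qed.

Local Notation "F • c" := (frog_move W F c) (at level 40).
Local Notation y := (displacement1 W).

Lemma frog_moveE F c m : ((F • c) m = (F m + y F c m) %% k :> nat).
Proof. by rewrite permE (inv_pos (leap_invariant_settle F c)) pad_shiftE. Qed.

Lemma displacement1_le F c m : y F c m <= k.
Proof. exact: inv_leap (leap_invariant_settle F c) m. Qed.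

Lemma frog_move_over F c (m : 'I_k) i : 0 < i < y F c m ->
  exists2 j : 'I_k, j < m & ((F • c) j = (F m + i) %% k :> nat).
Proof.
move=> /(inv_over (leap_invariant_settle F c)) [j jm jE].
by exists j => //; rewrite permE jE pad_shiftE.
Qed.

Lemma displacement1_gt0 F c m : (0 < y F c m) =
  (tnth W (F m) == c) || [exists j : 'I_k, (j < m) && ((F • c) j == F m)].
Proof.
have := inv_agitated (leap_invariant_settle F c) m.
rewrite settle_calm inE /= => ->; congr (_ || _).
by apply: eq_existsb => j; rewrite permE.
Qed.

(* A frog that is not on [c] leaves only when displaced, and so cannot return. *)
Lemma displacement1_full F c m : y F c m = k -> tnth W (F m) = c.
Proof.
move=> yk; have k0 : 0 < k by apply: leq_ltn_trans (ltn_ord m).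
have := displacement1_gt0 F c m; rewrite yk k0 => /esym/orP[/eqP//|].
case/existsP=> j /andP[jm /eqP jE].
suff mE : (F • c) m = F m by rewrite -mE in jE; rewrite (perm_inj jE) ltnn in jm.
by apply: val_inj; rewrite /= frog_moveE yk modnDr modn_small.
Qed.

End FrogStep.

(** * The local rule at one pad *)

Section Crossings.
Variables (k : nat) (k0 : 0 < k).

Definition pad (n : nat) : 'I_k := Ordinal (ltn_pmod n k0).

Lemma pad_ord (x : 'I_k) : pad x = x.
Proof. by apply: val_inj; rewrite /= modn_small. Qed.

Lemma pad_modD a b : pad (a %% k + b) = pad (a + b).
Proof. by apply: val_inj; rewrite /= modnDml. Qed.

Lemma eq_pad a b : (pad a == pad b) = (a == b %[mod k]).
Proof. by []. Qed.

(* A leap of length [y <= k] from [x] crosses the edge from [n - 1] to [n],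
   all positions being taken modulo [k]. The residue of [n - 1 - x] is written
   without subtraction. *)
Definition crosses (x y n : nat) : bool := (n + x.+1 * k.-1) %% k < y.

Lemma crosses_mod x y n : crosses (x %% k) y n = crosses x y n.
Proof.
rewrite /crosses; congr (_ < _); apply/eqP.
by rewrite eqn_modDl -modnMml -addn1 modnDml addn1 modnMml.
Qed.

Lemma crossesDr x y n : crosses x y (n + k) = crosses x y n.
Proof. by rewrite /crosses addnAC modnDr. Qed.

Lemma crosses_mod_edge x y n n' : n = n' %[mod k] -> crosses x y n = crosses x y n'.
Proof. by move=> e; rewrite /crosses -modnDml e modnDml. Qed.

Lemma crossesE x y n : x < n -> crosses x y n = ((n - x.+1) %% k < y).
Proof.
move=> xn; rewrite /crosses; congr (_ < _).
have -> : n + x.+1 * k.-1 = x.+1 * k + (n - x.+1).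
  by case: k k0 => // k' _ /=; rewrite mulnS; lia.
by rewrite modnMDl.
Qed.

Lemma crossesS x y d : d < k -> crosses x y (x + d).+1 = (d < y).
Proof. by move=> dk; rewrite crossesE ?ltnS ?leq_addr // subSS addKn modn_small. Qed.

(** The edge into the starting pad is the last one of the circle, so only a leap of full length
    crosses it. *)
Lemma crosses_src x y : y <= k -> crosses x y x = (y == k).
Proof.
move=> yk; rewrite -crossesDr -(prednK k0) addnS crossesS ?prednK //.
by case: k k0 yk => // k' _ /=; lia.
Qed.

Lemma sum_ord_ltS (f : 'I_k -> nat) (a : 'I_k) :
  \sum_(j < k | j < a.+1) f j = \sum_(j < k | j < a) f j + f a.
Proof.
rewrite (bigD1 a) ?ltnS //= addnC; congr (_ + _).
by apply: eq_bigl => j; rewrite ltnS ltn_neqAle andbC.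
Qed.

Definition occupied (t : nat) (F : arrangement k) (n : nat) : bool :=
  (F^-1)%g (pad n) < t.

Lemma occupiedS (a : 'I_k) F n :
  occupied a.+1 F n = occupied a F n || (F a == pad n).
Proof.
rewrite /occupied ltnS leq_eqVlt orbC val_eqE; congr (_ || _).
by apply/eqP/eqP => [<-|<-]; rewrite ?permKV ?permK.
Qed.

Lemma occupied_at (F : arrangement k) (a : 'I_k) t n :
  F a = pad n -> occupied t F n = (a < t).
Proof. by rewrite /occupied => <-; rewrite permK. Qed.

Lemma occupiedP (F : arrangement k) (j : 'I_k) t n :
  j < t -> F j = pad n -> occupied t F n.
Proof. by move=> jt /occupied_at->. Qed.

Lemma occupied_mod t F n n' : n = n' %[mod k] -> occupied t F n = occupied t F n'.
Proof. by move=> e; rewrite /occupied (_ : pad n = pad n') //; apply: val_inj. Qed.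

Section OneStep.
Variables (Sigma : finType) (W : k.-tuple Sigma) (F : arrangement k) (c : Sigma).
Local Notation F' := (frog_move W F c).
Local Notation y := (displacement1 W F c).

Definition crossings (t n : nat) : nat :=
  \sum_(j < k | j < t) crosses (F j) (y j) n.

Lemma crossings_mod t n n' : n = n' %[mod k] -> crossings t n = crossings t n'.
Proof.
by move=> e; apply: eq_bigr => j _; rewrite (crosses_mod_edge _ _ e).
Qed.

(* At a pad labelled [c] the passing frog and the occupant are exchanged; at any
   other pad the nastier of the two stays. This is what remains of that rule when
   only the [t] nastiest frogs are distinguished from the others. *)
Definition crossing_rule (t n : nat) : Prop :=
  if tnth W (pad n) == c
  then occupied t F' n = crossings t n :> nat /\ crossings t n.+1 = occupied t F n
  else occupied t F' n = maxn (occupied t F n) (crossings t n) :> nat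
    /\ crossings t n.+1 = minn (occupied t F n) (crossings t n).

Lemma crossing_rule_mod t n n' : n = n' %[mod k] -> crossing_rule t n -> crossing_rule t n'.
Proof.
move=> e; have eS : n.+1 = n'.+1 %[mod k] by rewrite -(addn1 n) -(addn1 n') -modnDml e modnDml.
rewrite /crossing_rule (crossings_mod t e) (crossings_mod t eS).
rewrite (occupied_mod _ F' e) (occupied_mod _ F e).
by have -> : pad n = pad n' by apply: val_inj.
Qed.

(** Adding frog [a] changes the counts only along its own leap, and there no nastier frog crosses an
    edge. What remains is a check of the pad where the leap starts, the pads under it, the pad where
    it ends and those beyond. *)
Lemma crossing_rule_step (a : 'I_k) :
  (forall n, crossing_rule a n) -> forall n, crossing_rule a.+1 n.
Proof.
move=> IH n; set x : nat := F a; pose d := (n + (k - x)) %% k.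
have dk : d < k by rewrite ltn_mod.
have xk : x < k by apply: ltn_ord.
have xd : x + d = n %[mod k].
  by rewrite modnDmr addnCA subnKC ?(ltnW xk) // modnDr.
apply: crossing_rule_mod xd _.
have padx : pad x = F a by apply: pad_ord.
have pad_eq i : (F a == pad (x + i)) = (i %% k == 0).
  by rewrite -padx eq_pad -[X in X == _ %[mod k]]addn0 eqn_modDl mod0n eq_sym.
have yk : y a <= k by apply: displacement1_le.
have land : F' a = pad (x + y a) by apply: ord_inj; rewrite frog_moveE.
have land_eq i : (F' a == pad (x + i)) = (y a == i %[mod k]).
  by rewrite land eq_pad eqn_modDl.
have over i : 0 < i < y a -> occupied a F' (x + i).
  move=> /frog_move_over [j ja jE]; apply: occupiedP ja _.
  exact: ord_inj.
have free : occupied a F' (x + y a) = false.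
  by rewrite (occupied_at _ land) ltnn.
have start : (0 < y a) = (tnth W (pad x) == c) || occupied a F' x.
  rewrite displacement1_gt0 padx; congr (_ || _).
  apply/existsP/idP => [[j /andP[ja /eqP jE]]|].
    by apply: occupiedP ja _; rewrite jE padx.
  move=> occ; exists ((F'^-1)%g (pad x)); apply/andP; split => //.
  by rewrite permKV padx.
have unocc : occupied a F x = false.
  by rewrite (occupied_at _ (esym padx)) ltnn.
(* A pad under the leap carries a nastier frog afterwards although none has arrived; so it is not
   labelled [c], and by the rule nothing leaves it. *)
have uncrossed i : i < y a -> crossings a (x + i).+1 = 0.
  elim: i => [|i IHi] iy.
    rewrite addn0; have := IH x; rewrite /crossing_rule unocc.
    by case: ifP => _ [_ ->] //; rewrite min0n.
  have := IH (x + i.+1); rewrite /crossing_rule over // addnS.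
  rewrite IHi ?(ltnW iy) //.
  by case: ifP => _ [] //; rewrite minn0.
have old := IH (x + d).
have crD n' : crossings a.+1 n' = crossings a n' + crosses x (y a) n'.
  exact: sum_ord_ltS.
have occ' := occupiedS a F' (x + d); rewrite land_eq in occ'.
have occ := occupiedS a F (x + d); rewrite pad_eq (modn_small dk) in occ.
have cr := crD (x + d); have crS := crD (x + d).+1.
rewrite crossesS // in crS.
move: old; rewrite /crossing_rule {}occ {}occ' {}cr {}crS (modn_small dk).
have [d0|d0] := posnP d.
  rewrite d0 addn0 unocc crosses_src //. rewrite orbT.
  have b1 : 0 < y a -> crossings a x.+1 = 0.
    by move=> y0; have := uncrossed 0 y0; rewrite addn0.
  (* After a full circle the starting pad is also the landing pad. *)
  case: (eqVneq (y a) k) => [yaE|yNk].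
    have bx : crossings a x = 0.
      have kE : x + k = (x + k.-1).+1 by rewrite -addnS prednK.
      by rewrite -(crossings_mod a (modnDr x k)) kE uncrossed // yaE prednK.
    have zx : occupied a F' x = false.
      by move: free; rewrite yaE (occupied_mod a _ (modnDr x k)).
    move: start; rewrite yaE k0 zx orbF modnn => <-.
    by rewrite bx b1 ?yaE.
  have ylt : y a < k by rewrite ltn_neqAle yNk.
  rewrite (modn_small ylt) addn0.
  move: start b1; case: (posnP (y a)) => [_|y0] /=.
    move=> /esym/negbT/norP[/negPf-> /negPf->] _ /=; lia.
  move=> /esym st /(_ isT) b1; rewrite b1 orbF.
  case: ifP st => [cx _|_] /=; first by case: (occupied _ _ _) => /=; lia.
  by move=> -> /=; lia.
rewrite orbF.
have crd : crosses x (y a) (x + d) = (d <= y a).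
  by rewrite -(prednK d0) addnS crossesS ?prednK //; apply: ltnW.
have yd : (y a %% k == d) = (y a == d).
  case: (ltngtP (y a) k) yk => // [/modn_small->//|-> _].
  by rewrite modnn eq_sym (gtn_eqF d0) gtn_eqF.
rewrite crd yd.
have bd : d <= y a -> crossings a (x + d) = 0.
  by move=> dy; rewrite -(prednK d0) addnS uncrossed ?prednK.
have bdS : d < y a -> crossings a (x + d).+1 = 0 by apply: uncrossed.
have zd : d < y a -> occupied a F' (x + d) by move=> dy; apply: over; rewrite d0.
case: (ltngtP d (y a)) => [dy|dy|dy].
- rewrite bd ?(ltnW dy) // bdS // zd //=.
  by case: ifP => _; case: (occupied _ F _) => /=; lia.
- by rewrite !addn0 orbF.
- have z0 : occupied a F' (x + d) = false by rewrite dy.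
  rewrite z0 bd ?dy //=.
  by case: ifP => _; case: (occupied _ F _) => /=; lia.
Qed.

Lemma crossingP t n : t <= k -> crossing_rule t n.
Proof.
elim: t n => [|t IHt] n tk; last exact: (@crossing_rule_step (Ordinal tk)) (fun m => IHt m (ltnW tk)) n.
by rewrite /crossing_rule /crossings /occupied !big_pred0 //; case: ifP.
Qed.

Lemma crossings_le1 t n : t <= k -> crossings t n <= 1.
Proof.
move=> /(crossingP n); rewrite /crossing_rule.
by case: ifP => _ []; case: (occupied t F' n) => /=; case: (occupied t F n) => /=; lia.
Qed.

End OneStep.
End Crossings.

(** * Counting trails *)

Section Trails.
Variables (k : nat) (k0 : 0 < k).

(* The number of positions [x + j k < n]: the part below [n] of the trail of a
   frog at [x]. *)
Definition trail (x n : nat) : nat := (n - x + k.-1) %/ k.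

Lemma trail0 x : trail x 0 = 0.
Proof. by rewrite /trail sub0n add0n divn_small // prednK. Qed.

Lemma trailS x n : trail x n.+1 = trail x n + ((x <= n) && (pad k0 x == pad k0 n)).
Proof.
rewrite /trail; case: leqP => xn /=; last first.
  have -> : n.+1 - x = 0 by lia.
  by rewrite addn0; have -> : n - x = 0 by lia.
rewrite subSn // -(subnKC xn) addKn; set d := n - x.
rewrite -[X in pad k0 X]addn0 eq_pad eqn_modDl mod0n.
rewrite addSnnS prednK // divnDr // divnn k0 divnD //.
rewrite [k.-1 %/ k]divn_small ?prednK // addn0 [k.-1 %% k]modn_small ?prednK //.
by case: eqVneq (ltn_pmod d k0) => [<-|] /=; lia.
Qed.

(** The leap shifts the whole trail by [y <= k], so at most the last of its points below [n] reaches
    [n]; this happens exactly when the leap, seen modulo [k], crosses the edge into [n]. The factor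
    [x < n] discards trails that begin too late. *)
Lemma trail_leap x y n : y <= k ->
  trail x n = trail (x + y) n + ((x < n) && crosses k x y n).
Proof.
move=> yk; case: (ltnP x n) => xn /=; last first.
  rewrite /trail addn0; have -> : n - x = 0 by lia.
  by have -> : n - (x + y) = 0 by lia.
rewrite crossesE // /trail subnDA.
have -> : n - x = (n - x.+1).+1 by lia.
set q := n - x.+1; have qE := divn_eq q k; have bk := ltn_pmod q k0.
set b := q %% k in qE bk *; set a := q %/ k in qE *.
have -> : q.+1 + k.-1 = a * k + (b + k) by lia.
rewrite divnMDl // divnDr // divnn k0 (divn_small bk).
case: (ltnP b y) => bY.
  have [qy|qy] := leqP y q.+1.
    have -> : q.+1 - y + k.-1 = a * k + (b + k - y) by lia.
    rewrite divnMDl // divn_small; lia.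
  have -> : a = 0 by case: (a) qE => // a'; rewrite mulSn; lia.
  rewrite divn_small; lia.
have -> : q.+1 - y + k.-1 = a * k + ((b - y) + k) by lia.
by rewrite divnMDl // divnDr // divnn k0 divn_small //; lia.
Qed.

Lemma trail_bounds x n : n - x <= trail x n * k < n - x + k.
Proof.
rewrite /trail; have := divn_eq (n - x + k.-1) k; have := ltn_pmod (n - x + k.-1) k0.
by lia.
Qed.

End Trails.

(** * The LCS in terms of frog positions *)

Section LcsTrails.
Variables (Sigma : finType) (k : nat) (k0 : 0 < k) (W : k.-tuple Sigma).
Local Notation move := (frog_move W).

Fixpoint total_displacement (F : arrangement k) (r : seq Sigma) (m : 'I_k) : nat :=
  if r is c :: r' then
    displacement1 W F c m + total_displacement (move F c) r' m
  else 0.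

Lemma total_displacement_cat F r1 r2 m : total_displacement F (r1 ++ r2) m =
  total_displacement F r1 m + total_displacement (foldl move F r1) r2 m.
Proof. by elim: r1 F => //= c r1 IH F; rewrite IH addnA. Qed.

Lemma total_displacement_rcons F r c m : total_displacement F (rcons r c) m =
  total_displacement F r m + displacement1 W (foldl move F r) c m.
Proof. by rewrite -cats1 total_displacement_cat /= addn0. Qed.

Lemma displacementE F n (r : n.-tuple Sigma) m :
  displacement W F r m = total_displacement F r m.
Proof.
rewrite /displacement.
suff total_take (s : seq Sigma) x0 G : total_displacement G s m =
    \sum_(t < size s) displacement1 W (foldl move G (take t s)) (nth x0 s t) m.
  (* The empty word offers no default letter for [nth]. *)
  case: n r => [|n] r; first by rewrite big_ord0 tuple0.
  rewrite (total_take r (tnth r ord0)) size_tuple.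
  by apply: eq_bigr => t _; rewrite (tnth_nth (tnth r ord0)).
elim: s G => [|c s IH] G; first by rewrite big_ord0.
by rewrite /= IH big_ord_recl.
Qed.

Lemma foldl_moveE F r m :
  (foldl move F r m = (F m + total_displacement F r m) %% k :> nat).
Proof.
elim/last_ind: r => [|r c IH]; first by rewrite /= addn0 modn_small.
by rewrite -cats1 foldl_cat /= frog_moveE IH cats1 total_displacement_rcons modnDml addnA.
Qed.

Definition position (r : seq Sigma) (m : 'I_k) : nat :=
  m + total_displacement 1%g r m.

Lemma position_pad r m : pad k0 (position r m) = foldl move 1%g r m.
Proof. by apply: ord_inj; rewrite foldl_moveE perm1. Qed.

(* A frog cannot overtake a less nasty one: it would have to land beyond the pad
   where the latter finally sits. *)
Lemma position_lt r (m m' : 'I_k) : m < m' -> position r m < position r m'.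
Proof.
elim/last_ind: r => [|r c IH] mm'; first by rewrite /position /= !addn0.
move: IH => /(_ mm'); rewrite /position !total_displacement_rcons !addnA.
rewrite -!/(position r _); set G := foldl _ _ _ => lt; rewrite ltnNge.
apply/negP => le; set ym := displacement1 W G c m in le; set ym' := displacement1 W G c m' in le.
have landm : move G c m = pad k0 (position r m + ym).
  by apply: ord_inj; rewrite frog_moveE -position_pad /= modnDml.
have landm' : move G c m' = pad k0 (position r m' + ym').
  by apply: ord_inj; rewrite frog_moveE -position_pad /= modnDml.
have [e|ne] := eqVneq (position r m + ym) (position r m' + ym').
  by move: landm'; rewrite -e -landm => /perm_inj mE; rewrite mE ltnn in mm'.
have i_lt : 0 < position r m' + ym' - position r m < ym by lia.
have [j jm jE] := frog_move_over i_lt.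
suff jm' : move G c j = move G c m'.
  by move: (perm_inj jm') => jE'; rewrite jE' ltnNge ltnW in jm.
apply: ord_inj; rewrite jE landm' -position_pad /= modnDml; congr (_ %% _); lia.
Qed.

(** Positions increase with the index, so the frogs not beyond [n] form an initial segment. Its
    length is the threshold at which [crossing_rule] is applied at [n]. *)
Lemma position_prefix r n : exists2 t, t <= k & forall m, (position r m <= n) = (m < t).
Proof.
pose P t := (t == k) || [exists m : 'I_k, (m == t :> nat) && (n < position r m)].
have exP : exists t, P t by exists k; rewrite /P eqxx.
have [t Pt mint] := ex_minnP exP.
have tk : t <= k.
  by case/orP: Pt => [/eqP->|/existsP[m /andP[/eqP<- _]]] //; apply: ltnW.
exists t => // m; apply/idP/idP => [mn|mt]; last first.
  rewrite leqNgt; apply/negP => nm; suff : t <= m by rewrite leqNgt mt.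
  by apply: mint; apply/orP; right; apply/existsP; exists m; rewrite eqxx.
rewrite ltnNge; apply/negP => tm; case/orP: Pt => [/eqP tE|/existsP[a /andP[/eqP aE na]]].
  by have := leq_trans (ltn_ord m) (eq_leq (esym tE)); rewrite ltnNge tm.
have : position r a <= position r m.
  by move: tm; rewrite -aE leq_eqVlt => /orP[/eqP/ord_inj->|/(position_lt r)/ltnW].
by rewrite leqNgt (leq_ltn_trans mn na).
Qed.

Lemma periodic_wordS n :
  periodic_word W n.+1 = rcons (periodic_word W n) (tnth W (pad k0 n)).
Proof.
have : size W = k by rewrite size_tuple.
rewrite /periodic_word; case E: (val W) => [|w s] /= sk; first by exfalso; move: k0; rewrite -[X in 0 < X]sk.
by rewrite mkseqS (tnth_nth w) /= E sk.
Qed.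

Lemma periodic_word0 : periodic_word W 0 = [::].
Proof. by rewrite /periodic_word; case: (val W). Qed.

Lemma size_periodic_word n : size (periodic_word W n) = n.
Proof. by elim: n => [|n IH]; rewrite ?periodic_word0 // periodic_wordS size_rcons IH. Qed.

Lemma trails_crossed r c n :
  \sum_m trail k (position r m) n = \sum_m trail k (position (rcons r c) m) n +
    \sum_m (position r m < n) *
       crosses k (position r m) (displacement1 W (foldl move 1%g r) c m) n.
Proof.
rewrite -big_split; apply: eq_bigr => m _ /=.
rewrite {2}/position total_displacement_rcons addnA -/(position r m) mulnb.
by apply: trail_leap => //; apply: displacement1_le.
Qed.

Lemma trails_occupied r n t : (forall m, (position r m <= n) = (m < t)) ->
  \sum_m trail k (position r m) n.+1 =
  \sum_m trail k (position r m) n + occupied k0 t (foldl move 1%g r) n.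
Proof.
move=> prefix; under eq_bigr do rewrite (trailS k0).
rewrite big_split /=; congr (_ + _); set G := foldl _ _ _.
pose a : 'I_k := (G^-1)%g (pad k0 n).
have aE m : (pad k0 (position r m) == pad k0 n) = (m == a).
  by rewrite position_pad -/G /a; apply/eqP/eqP => [<-|->]; rewrite ?permK ?permKV.
under eq_bigr do rewrite aE prefix.
rewrite (bigD1 a) //= eqxx andbT big1 ?addn0 // => m /negPf->.
by rewrite andbF.
Qed.

(** With the threshold [t] of [position_prefix], the LCS grows by [1 - occupied] when the periodic
    word gets its letter [n], and by the number of crossings of the edge into [n] when [r] gets a
    letter. In these increments, [crossing_rule] is the recursion [lcs_rcons]. *)
Lemma lcs_trails r n :
  lcs r (periodic_word W n) + \sum_m trail k (position r m) n = n.
Proof.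
elim/last_ind: r n => [|r c IH] n.
  rewrite lcs0s add0n; elim: n => [|n IHn]; first by rewrite big1 // => m _; apply: trail0.
  have [t tk prefix] := position_prefix [::] n.
  rewrite (trails_occupied prefix) IHn /occupied /= invg1 perm1 -prefix.
  by rewrite /position /= addn0 leq_mod addn1.
elim: n => [|n IHn].
  by rewrite periodic_word0 lcss0 big1 // => m _; apply: trail0.
have [t tk prefix] := position_prefix r n.
move: (IH n) (IH n.+1) IHn (trails_crossed r c n) (trails_crossed r c n.+1).
move: (trails_occupied prefix).
rewrite periodic_wordS lcs_rcons.
set G := foldl _ _ _; set y := displacement1 W G c.
have cr_mod m e : crosses k (position r m) (y m) e = crosses k (G m) (y m) e.
  by rewrite -position_pad /= crosses_mod.
set b := \sum_m _ * crosses k _ _ n; set b' := \sum_m _ * crosses k _ _ n.+1.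
have b'E : b' = crossings W G c t n.+1.
  rewrite /crossings [RHS]big_mkcond; apply: eq_bigr => m _ /=.
  by rewrite ltnS prefix cr_mod; case: ifP; rewrite ?mul1n ?mul0n.
(* A frog exactly at position [n] may count in [crossings], but its trail has no point below [n]. It
   crosses the edge into its own pad only by a full leap, which requires the label [c]; so equality
   holds at other labels, and at [c] the inequality suffices. *)
have b_le : b <= crossings W G c t n.
  rewrite /crossings [leqRHS]big_mkcond; apply: leq_sum => m _ /=.
  rewrite -prefix cr_mod; case: ltnP => [/ltnW->|]; rewrite ?mul1n //.
have b_eq : tnth W (pad k0 n) != c -> b = crossings W G c t n.
  move=> nc; rewrite /crossings [RHS]big_mkcond; apply: eq_bigr => m _ /=.
  rewrite -prefix cr_mod; case: ltngtP; rewrite ?mul1n // => mn.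
  rewrite mul0n -cr_mod mn crosses_src ?displacement1_le //.
  apply/esym/eqP; rewrite eqb0; apply: contra nc => /eqP/displacement1_full <-.
  by rewrite -position_pad mn.
have := crossings_le1 k0 W G c n tk; have := crossingP k0 W G c n tk.
rewrite /crossing_rule eq_sym; case: eqVneq b_eq => [_ _|_ /(_ isT) bE] [_].
  rewrite -b'E mul1n; case: (occupied _ _ _ _) => /= -> ; lia.
rewrite -b'E -bE mul0n; case: (occupied _ _ _ _) => /= ->; lia.
Qed.

End LcsTrails.

(** * Synchronization and cycles *)

Section Irreducible.
Variables (Sigma : finType) (k : nat) (k0 : 0 < k) (W : k.-tuple Sigma).

Lemma periodic_reducible g : 0 < g < k -> g %| k ->
  (forall p, tnth W (pad k0 (p + g)) = tnth W (pad k0 p)) -> reducible_word W.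
Proof.
move=> /andP[g0 gk] gdvd per; have sW := size_tuple W.
have perM a p : tnth W (pad k0 (p + a * g)) = tnth W (pad k0 p).
  by elim: a => [|a IH]; rewrite ?addn0 // mulSn [g + _]addnC addnA per.
exists (take g W); rewrite size_takel ?sW ?(ltnW gk) //; split => //.
have w := tnth W (pad k0 0).
case E : (take g W) => [|w0 s].
  by have := f_equal size E; rewrite size_takel ?sW ?(ltnW gk) //= => gE; rewrite gE in g0.
rewrite /periodic_word -E size_takel ?sW ?(ltnW gk) //.
apply: (@eq_from_nth _ w0); rewrite ?size_mkseq ?sW // => i ik.
rewrite nth_mkseq // nth_take ?ltn_mod //.
have gmod : i %% g < k by apply: leq_trans (ltnW gk); rewrite ltn_mod.
transitivity (tnth W (pad k0 i)); first by rewrite (tnth_nth w0) /= modn_small.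
rewrite {1}(divn_eq i g) addnC perM (tnth_nth w0) /= modn_small //.
Qed.

Hypothesis irr : ~ reducible_word W.

(** Invariance under the shift by [i] implies invariance under the shift by [gcdn i k], a proper
    divisor of [k], which would make [W] reducible. *)
Lemma shift_mismatch i : 0 < i < k -> exists p, tnth W (pad k0 (p + i)) != tnth W (pad k0 p).
Proof.
move=> /andP[i0 ik].
have [/existsP[p pP]|] := boolP [exists p : 'I_k, tnth W (pad k0 (p + i)) != tnth W (pad k0 p)].
  by exists p.
move=> /existsPn eqW; exfalso; apply: irr.
have per p : tnth W (pad k0 (p + i)) = tnth W (pad k0 p).
  have := eqW (pad k0 p); rewrite negbK /= => /eqP.
  by rewrite pad_modD -[p %% k]addn0 pad_modD addn0.
have perM a p : tnth W (pad k0 (p + a * i)) = tnth W (pad k0 p).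
  by elim: a => [|a IH]; rewrite ?addn0 // mulSn [i + _]addnC addnA per.
apply: (@periodic_reducible (gcdn i k)).
- have gi : gcdn i k <= i by rewrite dvdn_leq // dvdn_gcdl.
  by rewrite gcdn_gt0 i0 (leq_ltn_trans gi ik).
- exact: dvdn_gcdr.
(* By Bezout, [q * i] is congruent to the gcd modulo [k]. *)
move=> p; have [u _] := Bezoutl k i0; case/dvdnP=> q qE.
rewrite -(perM q p) -qE; congr (tnth W _); apply: ord_inj => /=.
by rewrite [in RHS]addnA [in RHS]addnC modnMDl.
Qed.

Local Notation move := (frog_move W).

Definition aligned m p (F : arrangement k) := forall j : 'I_k, j < m -> F j = pad k0 (p + j).

Lemma pad_succ_inj i j : (pad k0 i.+1 == pad k0 j.+1) = (pad k0 i == pad k0 j).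
Proof. by rewrite !eq_pad -(addn1 i) -(addn1 j) eqn_modDr. Qed.

Section Step.
Variables (m p : nat) (F : arrangement k).
Hypothesis al : aligned m p F.
Local Notation c := (tnth W (pad k0 p)).

(** The letter read pokes the first frog, which leaps onto the second, and so on: each frog is
    dislodged by its predecessor. It stops after one pad because the nastier frogs end strictly
    behind that pad. *)
Lemma aligned_step (j : 'I_k) : j < m ->
  displacement1 W F c j = 1 /\ move F c j = pad k0 (p.+1 + j).
Proof.
case: j => j jk; elim/ltn_ind: j jk => j IH jk jm; set o : 'I_k := Ordinal jk.
have oE : o = j :> nat by [].
suff y1 : displacement1 W F c o = 1.
  by split=> //; apply: ord_inj; rewrite frog_moveE y1 al //= modnDml addn1.
apply/eqP; rewrite eqn_leq; apply/andP; split.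
  rewrite leqNgt; apply/negP => y2.
  have [//|j' j'j j'E] := @frog_move_over _ _ W F c o 1.
  have j'm : j' < m by apply: ltn_trans jm.
  have [_ j'E'] := IH j' j'j (ltn_ord j') j'm.
  have j'eq : Ordinal (ltn_ord j') = j' by apply: ord_inj.
  rewrite j'eq in j'E'; move: j'E; rewrite j'E' al //= modnDml addn1 addSn => /eqP.
  rewrite -[_ == _]/(pad k0 (p + j').+1 == pad k0 (p + j).+1) pad_succ_inj eq_pad eqn_modDl.
  by rewrite !modn_small // ltn_eqF.
rewrite displacement1_gt0 al //; case: j => [|j] in jk o oE jm IH *.
  by rewrite addn0 eqxx.
apply/orP; right; apply/existsP; exists (Ordinal (ltnW jk)).
have [_ ->] := IH j (ltnSn j) (ltnW jk) (ltnW jm).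
by rewrite ltnSn addSnnS eqxx.
Qed.

Lemma aligned_next : aligned m p.+1 (move F c).
Proof. by move=> j /aligned_step[]. Qed.

Variables (a : 'I_k) (i : nat).
Hypotheses (am : a = m :> nat) (ik : i < k) (Fa : F a = pad k0 (p + i)).

Lemma aligned_index : m <= i.
Proof.
rewrite leqNgt; apply/negP => im.
have /perm_inj := etrans Fa (esym (al (j := Ordinal ik) im)).
by move/(congr1 (@nat_of_ord k)); rewrite am => /= mi; rewrite mi ltnn in im.
Qed.

(** A longer leap would pass over some frog [j < m], which ends at [p + 1 + j]; this forces [j = i],
    against [m <= i]. *)
Lemma next_frog_le1 : displacement1 W F c a <= 1.
Proof.
rewrite leqNgt; apply/negP => y2.
have [//|j ja jE] := @frog_move_over _ _ W F c a 1.
rewrite am in ja; have [_ jE'] := aligned_step ja.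
move: jE; rewrite jE' Fa /= modnDml addn1 addSn => /eqP.
rewrite -[_ == _]/(pad k0 (p + j).+1 == pad k0 (p + i).+1) pad_succ_inj eq_pad eqn_modDl.
rewrite !modn_small // => /eqP ji; have := aligned_index.
by rewrite -ji leqNgt ja.
Qed.

(** The aligned frogs end on the pads [p + 1, ..., p + m], so they can dislodge frog [a] only at
    offset [m]. For [m = 0], offset [m] means that [a] sits on the pad being read. *)
Lemma next_frog_moves : (0 < displacement1 W F c a) =
  (tnth W (pad k0 (p + i)) == c) || (i == m).
Proof.
rewrite displacement1_gt0 Fa; case: (eqVneq i m) => [im|im]; last first.
  congr (_ || _); apply/negbTE/existsPn => j; apply/negP => /andP[ja].
  rewrite am in ja; have [_ ->] := aligned_step ja.
  rewrite addSnnS eq_pad eqn_modDl (modn_small ik) modn_small; last first.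
    by apply: leq_trans (ltn_ord a); rewrite am.
  move/eqP => ji; have := aligned_index; rewrite -ji leq_eqVlt => /orP[/eqP mE|]; last by rewrite ltnNge ja.
  by rewrite -ji -mE eqxx in im.
rewrite orbT; case: (posnP m) => [m0|m0]; first by rewrite im m0 addn0 eqxx.
apply/orP; right; apply/existsP.
have mk : m.-1 < k by rewrite (leq_ltn_trans (leq_pred m)) // -am.
exists (Ordinal mk); rewrite am /= prednK // leqnn /=.
have [|_ ->] := @aligned_step (Ordinal mk); first by rewrite /= prednK.
by rewrite addSnnS /= prednK // im.
Qed.

End Step.

Local Notation run F p := (foldl move F (periodic_word W p)).

Lemma run_next F p : run F p.+1 = move (run F p) (tnth W (pad k0 p)).
Proof. by rewrite (periodic_wordS k0) -cats1 foldl_cat. Qed.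

Lemma aligned_later m p q F : p <= q -> aligned m p (run F p) -> aligned m q (run F q).
Proof.
move=> /subnKC <-; elim: (q - p) => [|d IH] al; first by rewrite addn0.
by rewrite addnS run_next; apply/aligned_next/IH.
Qed.

Lemma pad_completion p : (p + (k - p %% k)) %% k = 0.
Proof. by rewrite -modnDml subnKC ?modnn // ltnW // ltn_mod. Qed.

Lemma aligned_more m F p : m < k -> aligned m p (run F p) ->
  exists q, aligned m.+1 q (run F q).
Proof.
move=> mk; set a := Ordinal mk.
(* The gap between the head and frog [a], modulo [k] and without subtraction. *)
pose i p := (run F p a + (k - p %% k)) %% k.
have ik p' : i p' < k by rewrite ltn_mod.
have Fa p' : run F p' a = pad k0 (p' + i p').
  apply: ord_inj; rewrite /= modnDmr addnCA -modnDmr pad_completion addn0.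
  by rewrite modn_small.
have done p' : aligned m p' (run F p') -> i p' = m -> aligned m.+1 p' (run F p').
  move=> al ipm j; rewrite ltnS leq_eqVlt => /orP[/eqP jm|/al//].
  have -> : j = a by apply: ord_inj.
  by rewrite Fa ipm.
have stay p' : aligned m p' (run F p') ->
    tnth W (pad k0 (p' + i p')) = tnth W (pad k0 p') -> i p'.+1 = i p'.
  move=> al eqW; have le1 := next_frog_le1 al (erefl : a = m :> nat) (ik p') (Fa p').
  have := next_frog_moves al (erefl : a = m :> nat) (ik p') (Fa p').
  rewrite eqW eqxx /= => gt0.
  have /(congr1 (@nat_of_ord k)) := Fa p'.+1.
  rewrite run_next frog_moveE (_ : displacement1 _ _ _ _ = 1); last lia.
  rewrite Fa /= modnDml addn1 addSn => /esym/eqP.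
  rewrite -[_ == _]/(pad k0 _.+1 == pad k0 _.+1) pad_succ_inj eq_pad eqn_modDl.
  by rewrite !modn_small // => /eqP.
have drop p' : aligned m p' (run F p') -> i p' != m ->
    tnth W (pad k0 (p' + i p')) != tnth W (pad k0 p') -> i p'.+1 < i p'.
  move=> al iNm neqW; have := next_frog_moves al (erefl : a = m :> nat) (ik p') (Fa p').
  rewrite (negPf neqW) (negPf iNm) /= => y0.
  have /(congr1 (@nat_of_ord k)) := Fa p'.+1.
  rewrite run_next frog_moveE (_ : displacement1 _ _ _ _ = 0); last lia.
  have mi := aligned_index al (erefl : a = m :> nat) (ik p') (Fa p').
  have i0 : 0 < i p' by rewrite lt0n; apply: contraNneq iNm => i0; move: mi; rewrite i0 leqn0 eq_sym.
  rewrite Fa /= modnDml addn0 -(prednK i0) addnS addSn => /eqP.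
  rewrite -[_ == _]/(pad k0 _.+1 == pad k0 _.+1) pad_succ_inj eq_pad eqn_modDl.
  rewrite !modn_small ?prednK //; last exact: ltnW.
  by move=> /eqP <-; rewrite prednK.
move: {2}(i p).+1 (ltnSn (i p)) => n; elim: n p => // n IH p ipn al.
have [im|iNm] := eqVneq (i p) m; first by exists p; apply: done.
have [|q0 q0P] := @shift_mismatch (i p).
  rewrite ik andbT lt0n; apply: contraNneq iNm => i0.
  by have := aligned_index al (erefl : a = m :> nat) (ik p) (Fa p); rewrite i0 leqn0 eq_sym.
(* By periodicity the mismatch at [q0] recurs ahead of the head. Up to the first mismatch the gap is
   constant, and there it drops. *)
have exq : exists d, tnth W (pad k0 (p + d + i p)) != tnth W (pad k0 (p + d)).
  exists (q0 + (k - p %% k)).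
  have padE : pad k0 (p + (q0 + (k - p %% k))) = pad k0 q0.
    by apply: ord_inj; rewrite /= addnCA -modnDmr pad_completion addn0.
  rewrite padE -pad_modD (_ : _ %% k = q0 %% k) ?pad_modD //.
  exact: (congr1 (@nat_of_ord k) padE).
have [d dP dmin] := ex_minnP exq.
have keep e : e <= d -> i (p + e) = i p.
  elim: e => [|e IHe] ed; first by rewrite addn0.
  have alE : aligned m (p + e) (run F (p + e)) by apply: aligned_later al; apply: leq_addr.
  rewrite addnS stay // ?IHe ?(ltnW ed) //.
  by apply/eqP/negPn/negP => /dmin; rewrite leqNgt ed.
have alD : aligned m (p + d) (run F (p + d)) by apply: aligned_later al; apply: leq_addr.
apply: (IH (p + d).+1); last by apply: aligned_later al; rewrite -addnS leq_addr.
by apply: leq_trans (drop _ alD _ _) _; rewrite keep.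
Qed.

Lemma aligned_all F : exists q, aligned k q (run F q).
Proof.
suff al m : m <= k -> exists q, aligned m q (run F q) by apply: al.
elim: m => [|m IH] mk; first by exists 0.
by have [q /(aligned_more mk)] := IH (ltnW mk).
Qed.

Lemma synchronizing_word : exists w : seq Sigma, forall F, foldl move F w = 1%g.
Proof.
have [q qP] := fin_all_exists aligned_all.
(* After a multiple of [k] letters the head is back at pad 0, where full alignment means the
   identity arrangement. *)
pose N := \max_F q F; exists (periodic_word W (N * k)) => F.
apply/permP => j; rewrite perm1.
have -> // : run F (N * k) j = pad k0 (N * k + j).
  have le : q F <= N * k by apply: leq_trans (leq_bigmax F) _; rewrite leq_pmulr.
  exact: aligned_later le (qP F) j (ltn_ord j).
by apply: ord_inj; rewrite /= modnMDl modn_small.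
Qed.

Lemma aligned_run1 p : aligned k p (run 1%g p).
Proof.
apply: (@aligned_later k 0) => // j _.
by rewrite periodic_word0 perm1 pad_ord.
Qed.

Lemma run1_period : run 1%g k = 1%g.
Proof.
apply/permP => m; apply: ord_inj.
by rewrite aligned_run1 //= perm1 -modnDml modnn add0n modn_small.
Qed.

Lemma run1_displacement p m : total_displacement W 1%g (periodic_word W p) m = p.
Proof.
elim: p => [|p IH]; first by rewrite periodic_word0.
rewrite (periodic_wordS k0) total_displacement_rcons IH.
by have [->] := aligned_step (aligned_run1 p) (ltn_ord m); rewrite addn1.
Qed.

End Irreducible.

(** * Cycles under a constant word *)

Section ConstantWord.
Variables (Sigma : finType) (k : nat) (k0 : 0 < k) (W : k.-tuple Sigma) (c : Sigma).
Local Notation move := (frog_move W).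
Local Notation orbit G i := (foldl move G (nseq i c)).

(** [crossing_rule] with the threshold just above the present occupant: off [c], [occupied] cannot
    become false. *)
Lemma occupant_nastier (F : arrangement k) (x : 'I_k) :
  tnth W x != c -> ((move F c)^-1)%g x <= (F^-1)%g x.
Proof.
move=> xc; have := crossingP k0 W F c x (ltn_ord ((F^-1)%g x)).
rewrite /crossing_rule pad_ord (negPf xc) => -[+ _].
rewrite /occupied pad_ord ltnSn -ltnS; case: ltnP => //=; lia.
Qed.

Lemma orbitS G i : orbit G i.+1 = move (orbit G i) c.
Proof. by rewrite -addn1 nseqD foldl_cat. Qed.

Section Cycle.
Variables (G : arrangement k) (p : nat).
Hypotheses (p0 : 0 < p) (cyc : orbit G p = G).

Lemma orbitD i : orbit G (i + p) = orbit G i.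
Proof. by rewrite addnC nseqD foldl_cat cyc. Qed.

(** The index of the occupant never increases, and on a cycle it has to return to its value. *)
Lemma occupant_constant i (x : 'I_k) :
  tnth W x != c -> ((orbit G i.+1)^-1)%g x = ((orbit G i)^-1)%g x.
Proof.
move=> xc; apply: ord_inj; apply/eqP; rewrite eqn_leq orbitS occupant_nastier //=.
rewrite -orbitS -[in leqLHS]orbitD -(prednK p0) addnS -addSn.
elim: p.-1 => [|d IH]; first by rewrite addn0.
by apply: leq_trans IH; rewrite [in leqLHS]addnS orbitS occupant_nastier.
Qed.

Lemma settled_next i (m : 'I_k) : tnth W (orbit G i m) != c ->
  orbit G i.+1 m = orbit G i m.
Proof.
move=> xc; have /(congr1 (orbit G i.+1)) := occupant_constant i xc.
by rewrite permKV permK.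
Qed.

Lemma settled_prev i (m : 'I_k) : tnth W (orbit G i.+1 m) != c ->
  tnth W (orbit G i m) != c.
Proof.
move=> xc; have /(congr1 (orbit G i)) := occupant_constant i xc.
by rewrite permKV permK => ->.
Qed.

Lemma settled_displacement i (m : 'I_k) : tnth W (orbit G i m) != c ->
  displacement1 W (orbit G i) c m = 0.
Proof.
move=> xc; have /(congr1 (@nat_of_ord k)) := settled_next xc.
have le := displacement1_le W (orbit G i) c m.
have [yk|yNk] := eqVneq (displacement1 W (orbit G i) c m) k.
  by rewrite (displacement1_full yk) eqxx in xc.
rewrite orbitS frog_moveE => /eqP.
rewrite -[X in _ == X](modn_small (ltn_ord _)) -[X in _ == X %[mod _]]addn0 eqn_modDl.
by rewrite mod0n modn_small ?ltn_neqAle ?yNk // => /eqP.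
Qed.

Let q := \sum_(x < k) (tnth W x == c).
Let marked n := \sum_(i < n) (tnth W (pad k0 i) == c).

Lemma marked_period n : marked (n + k) = marked n + q.
Proof.
elim: n => [|n IH].
  rewrite /marked big_ord0 !add0n; apply: eq_bigr => i _; by rewrite pad_ord.
rewrite addSn /marked !big_ord_recr /= -/(marked _) -/(marked n) IH -!addnA; congr (_ + _).
rewrite addnC; congr (nat_of_bool (tnth W _ == c) + _).
by apply: ord_inj; rewrite /= modnDr.
Qed.

Lemma marked_periods a n : marked (n + a * k) = marked n + a * q.
Proof.
elim: a => [|a IH]; first by rewrite !addn0.
by rewrite !mulSn [k + _]addnC addnA marked_period IH -addnA [_ * q + _]addnC.
Qed.

(* Either the frog is settled on a pad not labelled [c], or each of its leaps
   passes at least one of the [q < k] pads labelled [c], so that it runs faster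
   than one pad per letter. *)
Lemma cycle_displacement (m : 'I_k) : q < k ->
  total_displacement W G (nseq p c) m <> p.
Proof.
move=> qk; have dispS i : total_displacement W G (nseq i.+1 c) m =
    total_displacement W G (nseq i c) m + displacement1 W (orbit G i) c m.
  by rewrite -addn1 nseqD total_displacement_cat /= addn0.
have [Gc|Gc] := boolP (tnth W (G m) == c); last first.
  suff -> : total_displacement W G (nseq p c) m = 0 by move=> pE; move: p0; rewrite -pE.
  suff settled i : tnth W (orbit G i m) != c /\
      total_displacement W G (nseq i c) m = 0 by case: (settled p).
  elim: i => [|i [xc IH]]; first by [].
  by rewrite dispS IH settled_displacement // settled_next.
set X := fun i => G m + total_displacement W G (nseq i c) m.
have Xpad i : pad k0 (X i) = orbit G i m by apply: ord_inj; rewrite foldl_moveE.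
have onc i : tnth W (orbit G i m) == c.
  by elim: i => [|i IH] //; apply: contraLR IH; apply: settled_prev.
(* Every leap starts on a position labelled [c], so [marked] grows by at least one per letter. *)
have count i : marked (X 0) + i <= marked (X i).
  elim: i => [|i IH]; first by rewrite addn0.
  have y0 : 0 < displacement1 W (orbit G i) c m by rewrite displacement1_gt0 onc.
  have -> : X i.+1 = (X i).+1 + (displacement1 W (orbit G i) c m).-1.
    by rewrite /X dispS -{1}(prednK y0); lia.
  rewrite addnS; apply: (@leq_trans (marked (X i).+1)).
    by rewrite /marked big_ord_recr /= -/(marked (X i)) Xpad onc addn1 ltnS.
  elim: _.-1 => [|d IHd]; first by rewrite addn0.
  by apply: leq_trans IHd _; rewrite addnS /marked [leqRHS]big_ord_recr leq_addr.
move=> pE; have := count p; rewrite /X pE /= addn0.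
(* On a closed orbit a displacement [p] is a multiple [a * k], along which [marked] grows only by
   [a * q < a * k = p]. *)
have /dvdnP[a aE] : k %| p.
  have := congr1 (@nat_of_ord k) (f_equal (fun F : arrangement k => F m) cyc).
  rewrite foldl_moveE pE => /eqP.
  rewrite -[X in _ == X](modn_small (ltn_ord _)) -[X in _ == X %[mod _]]addn0 eqn_modDl.
  by rewrite mod0n.
rewrite [in X in _ <= X]aE marked_periods leq_add2l aE leq_mul2l leqNgt qk orbF.
by move=> /eqP a0; move: p0; rewrite aE a0.
Qed.

End Cycle.
End ConstantWord.

Lemma off_speed_cycle (Sigma : finType) k (k0 : 0 < k) (W : k.-tuple Sigma) (F : arrangement k) m :
  1 < #|Sigma| ->
  exists v r, [/\ foldl (frog_move W) F (v ++ r) = foldl (frog_move W) F v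
    & total_displacement W (foldl (frog_move W) F v) r m <> size r].
Proof.
move=> /card_gt1P[c1 [c2 [_ _ c12]]].
(* Pad 0 does not carry this letter, which gives [q < k]. *)
have [c cW] : exists c, tnth W (pad k0 0) != c.
  have [e|] := eqVneq (tnth W (pad k0 0)) c1; last by exists c1.
  by exists c2; rewrite e.
have qk : \sum_(x < k) (tnth W x == c) < k.
  rewrite -[X in _ < X]card_ord -sum1_card (bigD1 (pad k0 0)) //= (negPf cW).
  rewrite [X in _ < X](bigD1 (pad k0 0)) //= add0n add1n ltnS.
  by apply: leq_sum => x _; case: eqP.
pose f (i : 'I_#|arrangement k|.+1) := foldl (frog_move W) F (nseq i c).
have /injectivePn[i [j ij fij]] : ~~ injectiveb f.
  by apply/injectiveP => /leq_card; rewrite card_ord ltnn.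
wlog lt : i j ij fij / i < j.
  move=> th; case: (ltngtP i j) => [||/ord_inj e]; first exact: th ij fij.
    by apply: th (esym fij); rewrite eq_sym.
  by rewrite e eqxx in ij.
have ijE : nseq i c ++ nseq (j - i) c = nseq j c by rewrite -nseqD subnKC // ltnW.
exists (nseq i c), (nseq (j - i) c); rewrite ijE; split=> //.
rewrite size_nseq; apply: cycle_displacement => //; first by rewrite subn_gt0.
by rewrite -foldl_cat ijE; exact: esym fij.
Qed.

Import Order.TTheory GRing.Theory Num.Theory.
Import numFieldNormedType.Exports.

Local Open Scope classical_set_scope.
Local Open Scope ring_scope.

(** * Additive functionals of a synchronizing automaton *)

Section Expectation.
Variables (R : realType) (T : finType) (t0 : T).
Implicit Types f g : T -> R.
Local Notation expect := (@expect R _).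

Lemma card_gt0R : 0 < #|T|%:R :> R.
Proof. by rewrite ltr0n; apply/card_gt0P; exists t0. Qed.

Lemma expectD f g : expect (fun x => f x + g x) = expect f + expect g.
Proof. by rewrite /expect big_split mulrDl. Qed.

Lemma expectZ a f : expect (fun x => a * f x) = a * expect f.
Proof. by rewrite /expect -mulr_sumr mulrA. Qed.

Lemma expectN f : expect (fun x => - f x) = - expect f.
Proof. by rewrite /expect sumrN mulNr. Qed.

Lemma expect_cst a : expect (fun _ : T => a) = a.
Proof. by rewrite /expect sumr_const -[_ *+ _]mulr_natr; apply: mulfK; rewrite gt_eqF // card_gt0R. Qed.

Lemma eq_expect f g : (forall x, f x = g x) -> expect f = expect g.
Proof. by move=> fg; rewrite /expect; under eq_bigr do rewrite fg. Qed.

Lemma expect_le f g : (forall x, f x <= g x) -> expect f <= expect g.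
Proof. by move=> fg; rewrite ler_pM2r ?invr_gt0 ?card_gt0R //; apply: ler_sum. Qed.

Lemma expect_norm f : `|expect f| <= expect (fun x => `|f x|).
Proof.
by rewrite normrM normfV normr_nat ler_pM2r ?invr_gt0 ?card_gt0R //; apply: ler_norm_sum.
Qed.

Lemma expect_eq_max f a : (forall x, f x <= a) -> expect f = a -> forall x, f x = a.
Proof.
move=> fa Ef x; apply/eqP; rewrite eq_le fa /= leNgt; apply/negP => fxa.
suff : expect f < a by rewrite Ef ltxx.
rewrite -(expect_cst a) ltr_pM2r ?invr_gt0 ?card_gt0R //.
rewrite (bigD1 x) //= [ltRHS](bigD1 x) //= ltr_leD // ler_sum //.
Qed.

Lemma expect_diff_le f g h : (forall x, `|f x - g x| <= h x) ->
  `|expect f - expect g| <= expect h.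
Proof.
move=> fgh; rewrite -expectN -expectD; apply: le_trans (expect_norm _) _.
exact: expect_le.
Qed.

End Expectation.

Section WordMean.
Variables (R : realType) (Sigma : finType) (c0 : Sigma).
Implicit Types f g : seq Sigma -> R.
Local Notation expect := (@expect R _).

(** Averaging letter by letter makes conditioning on the first letter hold by definition. *)
Fixpoint word_mean n f : R :=
  if n is n'.+1 then expect (fun c => word_mean n' (fun w => f (c :: w))) else f [::].

Lemma word_meanS n f :
  word_mean n.+1 f = expect (fun c => word_mean n (fun w => f (c :: w))).
Proof. by []. Qed.

Lemma eq_word_mean n f g : (forall w, f w = g w) -> word_mean n f = word_mean n g.
Proof. by elim: n f g => [|n IH] f g fg //=; apply: eq_expect => c; apply: IH. Qed.

Lemma expect_tuple n f : expect (fun r : n.-tuple Sigma => f r) = word_mean n f.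
Proof.
elim: n f => [|n IH] f /=.
  rewrite /expect (big_pred1 [tuple]) => [|t]; last by apply/esym/eqP/val_inj; case: t => -[].
  by rewrite card_tuple expn0 divr1.
rewrite -(eq_expect (fun c => IH (fun w => f (c :: w)))) {1}/Defs.expect card_tuple expnS.
rewrite /Defs.expect card_tuple.
rewrite -[in RHS]mulr_suml natrM invfM mulrA [in LHS]mulrAC; congr (_ / _ / _).
rewrite pair_bigA /=.
rewrite (reindex (fun p : Sigma * n.-tuple Sigma => [tuple of p.1 :: p.2])) //=.
exists (fun t : n.+1.-tuple Sigma => (thead t, [tuple of behead t])) => [[c t] _|t _] /=.
  by congr (_, _); apply: val_inj.
by rewrite [RHS]tuple_eta.
Qed.

Lemma word_meanD n f g :
  word_mean n (fun w => f w + g w) = word_mean n f + word_mean n g.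
Proof.
by elim: n f g => [|n IH] f g //=; rewrite -expectD; apply: eq_expect => c; apply: IH.
Qed.

Lemma word_meanZ n a f : word_mean n (fun w => a * f w) = a * word_mean n f.
Proof. by elim: n f => [|n IH] f //=; rewrite -expectZ; apply: eq_expect => c; apply: IH. Qed.

Lemma word_meanN n f : word_mean n (fun w => - f w) = - word_mean n f.
Proof. by elim: n f => [|n IH] f //=; rewrite -expectN; apply: eq_expect => c; apply: IH. Qed.

Lemma word_meanB n f g :
  word_mean n (fun w => f w - g w) = word_mean n f - word_mean n g.
Proof. by rewrite word_meanD word_meanN. Qed.

Lemma word_mean_sum (I : finType) n (f : I -> seq Sigma -> R) :
  word_mean n (fun w => \sum_i f i w) = \sum_i word_mean n (f i).
Proof.
elim: n f => [|n IH] f //=; rewrite (eq_expect (fun c => IH _)).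
rewrite /expect exchange_big mulr_suml; by apply: eq_bigr.
Qed.

Lemma word_mean_cst n a : word_mean n (fun=> a) = a.
Proof. by elim: n => [|n IH] //=; rewrite (eq_expect (fun c => IH)) expect_cst. Qed.

Lemma word_mean_le n f g : (forall w, size w = n -> f w <= g w) ->
  word_mean n f <= word_mean n g.
Proof.
elim: n f g => [|n IH] f g fg /=; first exact: fg.
by apply: expect_le => // c; apply: IH => w sw; apply: fg; rewrite /= sw.
Qed.

Lemma word_mean_norm n f : `|word_mean n f| <= word_mean n (fun w => `|f w|).
Proof.
elim: n f => [|n IH] f //=; apply: le_trans (expect_norm c0 _) _.
by apply: expect_le.
Qed.

Lemma word_mean_near n f g C : (forall w, size w = n -> `|f w - g w| <= C) ->
  `|word_mean n f - word_mean n g| <= C.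
Proof.
move=> fg; rewrite -word_meanB; apply: le_trans (word_mean_norm _ _) _.
by rewrite -[leRHS](word_mean_cst n); apply: word_mean_le.
Qed.

Lemma word_mean_norm_le n f C :
  (forall w, size w = n -> `|f w| <= C) -> `|word_mean n f| <= C.
Proof.
move=> fC; apply: le_trans (word_mean_norm _ _) _.
by rewrite -[leRHS](word_mean_cst n); apply: word_mean_le.
Qed.

End WordMean.

(** * Poisson's equation *)

Section Automaton.
Variables (R : realType) (Sigma S : finType) (c0 : Sigma) (step : S -> Sigma -> S).
Variables (w0 : seq Sigma) (Fs : S).
Local Notation expect := (@expect R _).
Hypothesis sync : forall F, foldl step F w0 = Fs.

Local Notation P u F := (expect (fun c => u (step F c))).

(** At a maximum of [u] the constant is nonnegative, at a minimum nonpositive. Being harmonic, [u]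
    then keeps its extreme values along every word, and [w0] brings both extremes to [Fs]. *)
Lemma superharmonic_const (u : S -> R) a :
  (forall F, u F - P u F = a) -> a = 0 /\ forall F, u F = u Fs.
Proof.
move=> ua.
have [M _ Mmax] := @arg_maxP _ R _ Fs predT u isT.
have [m _ mmin] := @arg_minP _ R _ Fs predT u isT.
have a0 : a = 0.
  apply/eqP; rewrite eq_le -{1}(ua m) -(ua M) subr_le0 subr_ge0; apply/andP; split.
    by rewrite -[leLHS](expect_cst c0); apply: expect_le => // c; apply: mmin.
  by rewrite -[leRHS](expect_cst c0); apply: expect_le => // c; apply: Mmax.
split=> //.
have Pu F : P u F = u F by apply/eqP; rewrite eq_sym -subr_eq0 ua a0.
have maxE w F : u F = u M -> u (foldl step F w) = u M.
  elim: w F => //= c w IH F uF; apply: IH.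
  by apply: (expect_eq_max (c0) (f := fun c => u (step F c))) => [x|]; [exact: Mmax|rewrite Pu].
have minE w F : u F = u m -> u (foldl step F w) = u m.
  elim: w F => //= c w IH F uF; apply: IH; apply: oppr_inj.
  apply: (expect_eq_max (c0) (f := fun c => - u (step F c))) => [x|].
    by rewrite lerN2; apply: mmin.
  by rewrite expectN Pu uF.
have := maxE w0 M erefl; have := minE w0 m erefl; rewrite !sync => um uM F.
by apply/eqP; rewrite eq_le {1}uM um; apply/andP; split; [exact: Mmax | exact: mmin].
Qed.

(** A perturbation of rank one that makes [1 - P] invertible. If [poisson_op u = g], then
    [g - u Fs = u - P u], so [u Fs] is the stationary mean of [g]. *)
Definition poisson_op (u : {ffun S -> R^o}) : {ffun S -> R^o} :=
  [ffun F => u F - P u F + u Fs].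

Lemma poisson_op_linear : linear poisson_op.
Proof.
move=> a u v; apply/ffunP => F; rewrite !ffunE.
have -> : P (a *: u + v) F = a * P u F + P v F.
  by rewrite -expectZ -expectD; apply: eq_expect => c; rewrite !ffunE.
by rewrite /GRing.scale /=; ring.
Qed.

HB.instance Definition _ :=
  GRing.isLinear.Build R _ _ _ poisson_op poisson_op_linear.

Let T : 'End({ffun S -> R^o}) := linfun poisson_op.

Lemma poisson_op_ker : lker T == 0%VS.
Proof.
apply/lker0P => u v; rewrite !lfunE /= => Tuv; apply/eqP; rewrite -subr_eq0; apply/eqP.
have : poisson_op (u - v) = 0 by rewrite linearB /= Tuv subrr.
move=> /ffunP Tw; have [|c wc] := @superharmonic_const (u - v) (- (u - v) Fs).
  by move=> F; have := Tw F; rewrite /poisson_op !ffunE => /eqP; rewrite addr_eq0 => /eqP.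
apply/ffunP => F; rewrite wc; move/eqP: c; rewrite oppr_eq0 => /eqP ->.
by rewrite ffunE.
Qed.

Let mean (g : {ffun S -> R^o}) : R := (T^-1)%VF g Fs.

Let mean_eq (g : {ffun S -> R^o}) F : let u := (T^-1)%VF g in g F = u F - P u F + mean g.
Proof.
have /ffunP/(_ F) := lker0_lfunVK poisson_op_ker g.
by rewrite lfunE /= ffunE => <-.
Qed.

Let mean_unique (g : {ffun S -> R^o}) (u : S -> R) a :
  (forall F, g F = u F - P u F + a) -> a = mean g.
Proof.
move=> ga; pose w F := u F - (T^-1)%VF g F.
have [|+ _] := @superharmonic_const w (mean g - a).
  move=> F; rewrite /w expectD expectN.
  have := ga F; rewrite mean_eq; lra.
by move=> /eqP; rewrite subr_eq0 => /eqP.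
Qed.

(** The law gives [G] the mean of its indicator. It is characterized by solvability of Poisson's
    equation, from which [stationary_mean] later recovers invariance. *)
Lemma stationary_law : exists pi : {ffun S -> R},
  [/\ forall F, 0 <= pi F, \sum_F pi F = 1 &
   forall g : S -> R, exists u : S -> R, forall F,
      g F - \sum_G pi G * g G = u F - P u F].
Proof.
pose ind G : {ffun S -> R^o} := [ffun F => (F == G)%:R].
exists [ffun G => mean (ind G)].
have meanE (g : S -> R) : \sum_G [ffun G => mean (ind G)] G * g G = mean (finfun g).
  have -> : finfun g = \sum_G g G *: ind G.
    apply/ffunP => F; rewrite ffunE sum_ffunE (bigD1 F) //= !ffunE eqxx.
    rewrite big1 => [|G GF]; first by rewrite addr0 /GRing.scale /= mulr1.
    by rewrite !ffunE eq_sym (negPf GF) /GRing.scale /= mulr0.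
  rewrite /mean linear_sum sum_ffunE; apply: eq_bigr => G _.
  by rewrite linearZ !ffunE mulrC.
split.
- move=> G; rewrite ffunE; set u := (T^-1)%VF (ind G).
  (* At a minimum of [u] one has [u <= P u], so the mean is at least the value of the indicator
     there. *)
  have [m _ mmin] := @arg_minP _ R _ Fs predT u isT.
  have := mean_eq (ind G) m; rewrite -/u /= ffunE => e.
  have : u m <= P u m.
    by rewrite -[leLHS](expect_cst c0); apply: expect_le => // c; apply: mmin.
  have : 0 <= (m == G)%:R :> R by [].
  lra.
- have := meanE (fun=> 1); under eq_bigr do rewrite mulr1.
  move=> ->; apply/esym; apply: (@mean_unique _ (fun=> 0)) => F.
  by rewrite ffunE expect_cst // subrr add0r.
- move=> g; exists ((T^-1)%VF (finfun g)) => F.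
  rewrite meanE; have := mean_eq (finfun g) F; rewrite /= ffunE; lra.
Qed.

End Automaton.

(** * Coupling by common letters *)

Section Coupling.
Variables (R : realType) (Sigma S : finType) (c0 : Sigma) (step : S -> Sigma -> S).
Local Notation expect := (@expect R _).

(* The expected number of times before [n] at which the chains started at [F]
   and [G] and driven by the same letters differ. *)
Fixpoint mismatches n (F G : S) : R :=
  if n is n'.+1 then
    (F != G)%:R + expect (fun c => mismatches n' (step F c) (step G c))
  else 0.

Lemma mismatches_eq n F : mismatches n F F = 0.
Proof.
elim: n F => [|n IH] F //=; rewrite eqxx add0r.
by rewrite (eq_expect (fun c => IH _)) expect_cst.
Qed.

Let delta : R := #|Sigma|%:R^-1.

Let delta_gt0 : 0 < delta. Proof. by rewrite invr_gt0 card_gt0R. Qed.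

Let delta_le1 : delta <= 1.
Proof. by rewrite invf_le1 ?card_gt0R // ler1n; apply/card_gt0P; exists c0. Qed.

Lemma mismatches_word n v w F G : 0 <= v -> (forall F G, mismatches n F G <= v) ->
  foldl step F w = foldl step G w ->
  mismatches (size w + n) F G <= (size w)%:R + (1 - delta ^+ size w) * v.
Proof.
move=> v0 nv; elim: w F G => [|c w IH] F G /= FG.
  by rewrite add0n FG mismatches_eq add0r subrr mul0r.
have crude s F' G' : mismatches (s + n) F' G' <= s%:R + v.
  elim: s F' G' => [|s IHs] F' G'; first by rewrite add0r.
  rewrite addSn /= -[s.+1]add1n natrD -addrA; apply: lerD; first by case: (_ != _).
  by rewrite -[leRHS](expect_cst c0) expect_le.
apply: (@le_trans _ _ (1 + expect (fun a : Sigma => (size w)%:R + v -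
    (a == c)%:R * (delta ^+ size w * v)))).
  apply: lerD; first by case: (_ != _).
  apply: expect_le => // a; case: eqP => [->|_].
    by apply: le_trans (IH _ _ FG) _; rewrite mul1r mulrBl mul1r addrA.
  by rewrite mul0r subr0.
rewrite expectD expect_cst // expectN.
have -> : expect (fun a => (a == c)%:R * (delta ^+ size w * v)) = delta ^+ (size w).+1 * v.
  rewrite (eq_expect (fun a => mulrC _ _)) expectZ /Defs.expect.
  rewrite (bigD1 c) //= eqxx big1 => [|a /negPf->//].
  by rewrite addr0 mul1r exprS -/delta; ring.
rewrite -[(size w).+1]add1n natrD; lra.
Qed.

Lemma mismatches_bounded (w0 : seq Sigma) Fs : (forall F, foldl step F w0 = Fs) ->
  exists2 C, 0 <= C & forall n F G, mismatches n F G <= C.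
Proof.
(* The extra letter makes [w] nonempty, so that the induction removes at least one step. *)
move=> sync; pose w := c0 :: w0; pose L := size w.
have dL : 0 < delta ^+ L by rewrite exprn_gt0.
(* The fixed point of [v = L + (1 - delta ^+ L) * v]. *)
exists (L%:R / delta ^+ L); first by rewrite divr_ge0 // ltW.
have small n F G : mismatches n F G <= n%:R.
  elim: n F G => [|n IH] F G //=; rewrite -[n.+1]add1n natrD; apply: lerD; first by case: (_ != _).
  by rewrite -[leRHS](expect_cst c0) expect_le.
elim/ltn_ind => n IH F G; have [nL|Ln] := ltnP n L.
  apply: le_trans (small _ _ _) _; rewrite ler_pdivlMr //.
  apply: (@le_trans _ _ n%:R); last by rewrite ler_nat ltnW.
  by rewrite ler_piMr // exprn_ile1 // ltW.
have -> : n = (L + (n - L))%N by rewrite subnKC.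
apply: le_trans (@mismatches_word (n - L) (L%:R / delta ^+ L) w F G _ _ _) _.
- by rewrite divr_ge0 // ltW.
- by move=> F' G'; apply: IH; rewrite ltn_subrL /=; apply: leq_trans Ln.
- by rewrite /w /= !sync.
- by rewrite -/L mulrBl mul1r [delta ^+ L * _]mulrC divfK ?gt_eqF //; lra.
Qed.

Fixpoint path_sum (g : S -> Sigma -> R) F (w : seq Sigma) : R :=
  if w is c :: w' then g F c + path_sum g (step F c) w' else 0.

Lemma finite_bound (g : S -> Sigma -> R) : exists2 K, 0 <= K & forall F c, `|g F c| <= K.
Proof.
exists (\sum_F \sum_c `|g F c|); first by rewrite !sumr_ge0 // => F _; rewrite sumr_ge0.
move=> F c; rewrite (bigD1 F) //= (bigD1 c) //= -addrA lerDl addr_ge0 //.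
  by rewrite sumr_ge0.
by rewrite sumr_ge0 // => G _; rewrite sumr_ge0.
Qed.

End Coupling.

(** * Martingales driven by the chain *)

Section Martingale.
Variables (R : realType) (Sigma S : finType) (c0 : Sigma) (step : S -> Sigma -> S).
Variables (w0 : seq Sigma) (Fs : S).
Hypothesis sync : forall F, foldl step F w0 = Fs.
Variable d : S -> Sigma -> R.
Local Notation expect := (@expect R _).
Hypothesis centered : forall F, expect (d F) = 0.
Local Notation A := (path_sum step d).
Local Notation smooth phi n F y := (word_mean n (fun w => phi (y + A F w) : R)).

Lemma smoothS phi n F y :
  smooth phi n.+1 F y = expect (fun c => smooth phi n (step F c) (y + d F c)).
Proof. by apply: eq_expect => c; apply: eq_word_mean => w /=; rewrite addrA. Qed.

Lemma martingale_mean n F : word_mean n (A F) = 0.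
Proof.
elim: n F => [|n IH] F //=; rewrite -[RHS](centered F); apply: eq_expect => c.
by rewrite word_meanD // word_mean_cst // IH addr0.
Qed.

Lemma martingale_variance K n F : (forall F c, `|d F c| <= K) ->
  word_mean n (fun w => A F w ^+ 2) <= n%:R * K ^+ 2.
Proof.
move=> dK; elim: n F => [|n IH] F; first by rewrite /= expr0n mul0r.
rewrite word_meanS -(expect_cst c0 (n.+1%:R * _)); apply: expect_le => // c /=.
have -> : word_mean n (fun w => (d F c + A (step F c) w) ^+ 2) =
    d F c ^+ 2 + word_mean n (fun w => A (step F c) w ^+ 2).
  rewrite (@eq_word_mean _ _ _ _ (fun w => d F c ^+ 2 + 2 * d F c * A (step F c) w +
    A (step F c) w ^+ 2)) => [|w]; last by ring.
  by rewrite !word_meanD word_mean_cst // word_meanZ martingale_mean mulr0 addr0.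
rewrite -[n.+1]add1n natrD mulrDl mul1r; apply: lerD; last exact: IH.
by rewrite -real_normK ?num_real // lerXn2r ?nnegrE // (le_trans _ (dK F c)).
Qed.

Section TestFunction.
Variables (K V B B1 : R) (f f' : R -> R).
Hypotheses (K0 : 0 <= K) (dK : forall F c, `|d F c| <= K).
Hypotheses (V0 : 0 <= V) (mismatchV : forall n F G, mismatches R step n F G <= V).
Hypothesis f_taylor : forall x y, `|f (x + y) - f x - f' x * y| <= B * y ^+ 2.
Hypothesis f'_lip : forall x y, `|f' (x + y) - f' x| <= B * `|y|.
Hypothesis f'_bound : forall x, `|f' x| <= B1.

Let B_ge0 : 0 <= B.
Proof. by have := le_trans (normr_ge0 _) (f'_lip 0 1); rewrite normr1 mulr1. Qed.

Lemma smooth_lip n F x y : `|smooth f' n F (x + y) - smooth f' n F x| <= B * `|y|.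
Proof. by apply: word_mean_near => // w _; rewrite addrAC; apply: f'_lip. Qed.

Lemma smooth_taylor n F x y :
  `|smooth f n F (x + y) - smooth f n F x - smooth f' n F x * y| <= B * y ^+ 2.
Proof.
rewrite [_ * y]mulrC -word_meanZ -!word_meanB; apply: word_mean_norm_le => // w _.
by have := f_taylor (x + A F w) y; rewrite [x + _ + y]addrAC [f' _ * _]mulrC.
Qed.

(** Under the coupling, the two sums drift apart by at most [2 * K] at each time the states differ,
    and [f'] is [B]-Lipschitz. *)
Lemma smooth_lip_start n F G y :
  `|smooth f' n F y - smooth f' n G y| <= 2 * K * B * mismatches R step n F G.
Proof.
elim: n F G y => [|n IH] F G y; first by rewrite /= subrr normr0 mulr0.
have [<-|FG] := eqVneq F G; first by rewrite subrr normr0 mismatches_eq // mulr0.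
rewrite !smoothS /= FG mulrDr mulr1 -expectZ.
rewrite -[2 * K * B](expect_cst c0) -expectD; apply: (expect_diff_le c0) => c.
have := IH (step F c) (step G c) y.
have := smooth_lip n (step F c) y (d F c); have := smooth_lip n (step G c) y (d G c).
have := ler_wpM2l B_ge0 (dK F c); have := ler_wpM2l B_ge0 (dK G c).
rewrite !ler_norml expect_cst //.
move=> ? ? /andP[? ?] /andP[? ?] /andP[? ?]; apply/andP; split; lra.
Qed.

Lemma smooth_lip_startV n F G y : `|smooth f' n F y - smooth f' n G y| <= 2 * K * B * V.
Proof.
apply: le_trans (smooth_lip_start _ _ _ _) _; apply: ler_wpM2l => //.
by rewrite !mulr_ge0.
Qed.

Let C1 := K ^+ 2 + 2 * K ^+ 2 * V.

(* Since the increments are centred and the derivative of the smoothed function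
   hardly depends on the state, one step changes the mean by [O(B)]. *)
Lemma smooth_step n F y :
  `|smooth f n.+1 F y - expect (fun c => smooth f n (step F c) y)| <= C1 * B.
Proof.
rewrite smoothS.
have -> : expect (fun c => smooth f n (step F c) y) =
    expect (fun c => smooth f n (step F c) y + smooth f' n F y * d F c).
  by rewrite expectD expectZ centered mulr0 addr0.
rewrite -[leRHS](expect_cst c0); apply: (expect_diff_le c0) => c.
have := smooth_taylor n (step F c) y (d F c).
have := smooth_lip_startV n (step F c) F y.
have d2 : d F c ^+ 2 <= K ^+ 2.
  by rewrite -real_normK ?num_real // lerXn2r ?nnegrE // (le_trans _ (dK F c)).
set a := smooth f n _ (y + _); set b := smooth f n _ y; set p := smooth f' n _ y.
set p' := smooth f' n F y => pp' ab.
have e : a - (b + p' * d F c) = (a - b - p * d F c) + (p - p') * d F c by ring.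
rewrite e; apply: le_trans (ler_normD _ _) _.
have -> : C1 * B = B * K ^+ 2 + 2 * K * B * V * K by rewrite /C1; ring.
apply: lerD; first by apply: le_trans ab _; apply: ler_wpM2l.
by rewrite normrM; apply: ler_pM.
Qed.

(** Same coupling, but [smooth_step] drops the first increment on both sides at a cost of [C1 * B]
    each, so the argument [y] stays common and [sup |f'|] never enters. *)
Lemma smooth_start n F G y :
  `|smooth f n F y - smooth f n G y| <= 2 * C1 * B * mismatches R step n F G.
Proof.
elim: n F G y => [|n IH] F G y; first by rewrite /= subrr normr0 mulr0.
have [<-|FG] := eqVneq F G; first by rewrite subrr normr0 mismatches_eq // mulr0.
have := smooth_step n F y; have := smooth_step n G y.
have := expect_diff_le c0 (fun c => IH (step F c) (step G c) y).
rewrite expectZ [mismatches _ _ n.+1 _ _]/= FG [_ * (true%:R + _)]mulrDr mulr1.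
set a := smooth f n.+1 F y; set b := smooth f n.+1 G y.
rewrite !ler_norml.
move=> /andP[? ?] /andP[? ?] /andP[? ?]; apply/andP; split; lra.
Qed.

Let C1_ge0 : 0 <= C1.
Proof. by rewrite addr_ge0 ?mulr_ge0 ?exprn_ge0. Qed.

Lemma smooth_startV n F G y : `|smooth f n F y - smooth f n G y| <= 2 * C1 * B * V.
Proof.
apply: le_trans (smooth_start _ _ _ _) _; apply: ler_wpM2l => //.
by rewrite !mulr_ge0.
Qed.

Variable e : S -> Sigma -> R.
Hypothesis e_centered : forall F, expect (e F) = 0.

(** Condition on the first letter. Since [e] is centred, the smoothed [f'] may be reduced by its
    value at [F] and [y], which does not depend on that letter; the difference is [O(B)]. *)
Lemma compensator_mean E n F y : 0 <= E -> (forall F c, `|e F c| <= E) ->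
  `|word_mean n (fun w => path_sum step e F w * f' (y + A F w))|
     <= n%:R * (E * (B * K + 2 * K * B * V)).
Proof.
move=> E0 eE; elim: n F y => [|n IH] F y; first by rewrite /= mul0r normr0 mul0r.
have -> : word_mean n.+1 (fun w => path_sum step e F w * f' (y + A F w)) =
    expect (fun c => e F c * (smooth f' n (step F c) (y + d F c) - smooth f' n F y) +
      word_mean n (fun w => path_sum step e (step F c) w * f' (y + d F c + A (step F c) w))).
  under [RHS]eq_expect => c do rewrite mulrBr -addrA [- _ + _]addrC addrA.
  rewrite expectD expectN (eq_expect (fun c => mulrC (e F c) (smooth f' n F y))) expectZ.
  rewrite e_centered mulr0 subr0; apply: eq_expect => c /=.
  rewrite -word_meanZ -word_meanD; apply: eq_word_mean => w /=.
  by rewrite mulrDl addrA.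
apply: le_trans (expect_norm c0 _) _; rewrite -[leRHS](expect_cst c0).
apply: expect_le => // c; apply: le_trans (ler_normD _ _) _.
rewrite -[n.+1]add1n natrD mulrDl mul1r; apply: lerD; last exact: IH.
rewrite normrM; apply: ler_pM => //.
have := smooth_lip n (step F c) y (d F c); have := smooth_lip_startV n (step F c) F y.
have := ler_wpM2l B_ge0 (dK F c); rewrite !ler_norml.
move=> ? /andP[? ?] /andP[? ?]; apply/andP; split; lra.
Qed.

(** The summands come from changing the starting state, from the Taylor remainder, and from moving
    [f'] from [y] to [y + d F c]. *)
Let C2 := K * (2 * C1 * V + K ^+ 2 + K ^+ 2).

(** As in [compensator_mean], a term independent of the first letter is subtracted. The first-order
    Taylor term of the smoothed [f] then yields [d F c ^+ 2] times the smoothed [f']. *)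
Lemma stein_expansion n F y :
  `|word_mean n (fun w => A F w * f (y + A F w)) -
    word_mean n (fun w => path_sum step (fun F c => d F c ^+ 2) F w * f' (y + A F w))|
     <= n%:R * (C2 * B).
Proof.
elim: n F y => [|n IH] F y; first by rewrite /= !mul0r subrr normr0.
have -> : word_mean n.+1 (fun w => A F w * f (y + A F w)) =
    expect (fun c => d F c * (smooth f n (step F c) (y + d F c) - smooth f n F y) +
      word_mean n (fun w => A (step F c) w * f (y + d F c + A (step F c) w))).
  under [RHS]eq_expect => c do rewrite mulrBr -addrA [- _ + _]addrC addrA.
  rewrite expectD expectN (eq_expect (fun c => mulrC (d F c) (smooth f n F y))) expectZ.
  rewrite centered mulr0 subr0; apply: eq_expect => c /=.
  rewrite -word_meanZ -word_meanD; apply: eq_word_mean => w /=.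
  by rewrite mulrDl addrA.
have -> : word_mean n.+1 (fun w => path_sum step (fun F c => d F c ^+ 2) F w * f' (y + A F w)) =
    expect (fun c => d F c ^+ 2 * smooth f' n (step F c) (y + d F c) +
      word_mean n (fun w => path_sum step (fun F c => d F c ^+ 2) (step F c) w *
        f' (y + d F c + A (step F c) w))).
  apply: eq_expect => c /=.
  rewrite -word_meanZ -word_meanD; apply: eq_word_mean => w /=.
  by rewrite mulrDl addrA.
rewrite -[leRHS](expect_cst c0); apply: (expect_diff_le c0) => c.
have := IH (step F c) (y + d F c).
set Q := word_mean n _; set Q' := word_mean n _ => QQ'.
have := smooth_taylor n (step F c) y (d F c).
have := smooth_startV n (step F c) F y.
have := smooth_lip n (step F c) y (d F c).
set a' := smooth f' n _ (y + _); set p := smooth f' n _ y.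
set a := smooth f n _ (y + _); set b := smooth f n _ y.
set b0 := smooth f n F y => a'p bb0 ab.
have dd := dK F c; have d0 := normr_ge0 (d F c).
have d2 : d F c ^+ 2 <= K ^+ 2.
  by rewrite -real_normK ?num_real // lerXn2r ?nnegrE // (le_trans _ dd).
have -> : d F c * (a - b0) + Q - (d F c ^+ 2 * a' + Q') =
    d F c * ((a - b - p * d F c) + (b - b0) + (p - a') * d F c) + (Q - Q') by ring.
have -> : n.+1%:R * (C2 * B) = C2 * B + n%:R * (C2 * B) by rewrite -natr1; ring.
apply: le_trans (ler_normD _ _) _; apply: lerD QQ'.
have -> : C2 * B = K * (B * K ^+ 2 + 2 * C1 * B * V + B * K * K) by rewrite /C2; ring.
rewrite normrM; apply: ler_pM => //.
apply: le_trans (ler_normD _ _) _; apply: lerD.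
  apply: le_trans (ler_normD _ _) _; apply: lerD => //.
  by apply: le_trans ab _; apply: ler_wpM2l.
rewrite normrM distrC; apply: ler_pM => //.
by apply: le_trans a'p _; apply: ler_wpM2l.
Qed.

End TestFunction.
End Martingale.

(** * Stein's equation for the absolute value *)

Section SteinFunction.
Variable R : realType.

Lemma mean_value (f df : R -> R) (a b : R) : (forall x : R, is_derive x 1 f (df x)) ->
  a <= b -> exists c, [/\ a <= c, c <= b & f b - f a = df c * (b - a)].
Proof.
move=> fdf ab; have [|c + ->] := MVT_segment ab (fun x _ => fdf x).
  apply: continuous_subspaceT => x.
  by apply/differentiable_continuous/derivable1_diffP; case: (fdf x).
by rewrite in_itv /= => /andP[? ?]; exists c.
Qed.

Lemma derive_ge0_mono (f df : R -> R) (a b : R) : (forall x : R, is_derive x 1 f (df x)) ->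
  (forall x, a <= x -> 0 <= df x) -> a <= b -> f a <= f b.
Proof.
move=> fdf df0 ab; have [c [ac cb e]] := mean_value fdf ab.
by rewrite -subr_ge0 e mulr_ge0 ?df0 ?subr_ge0.
Qed.

Local Notation g := (@gauss_fun R).

Lemma is_derive_gauss (x : R) : is_derive x 1 g (- 2 * x * g x).
Proof.
have -> : g = expR \o (fun x => - (x ^+ 2)) by [].
by apply: is_derive_eq; rewrite /gauss_fun /= /GRing.scale /= !mulr1; ring.
Qed.

Lemma gauss_antiderivative : exists I : R -> R, forall x : R, is_derive x 1 I (g x).
Proof.
pose I x := \int[@lebesgue_measure R]_(t in `]-oo, x]) g t.
exists I => x; have [||||dI IE] := @continuous_FTC1 R g -oo%O x (x + 1).
- by rewrite ltrDl.
- by apply: (integrableS _ _ _ (@integrableT_gauss R)) => //; exact: measurable_itv.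
- by rewrite ltNyr.
- exact: continuous_gauss_fun.
by apply: DeriveDef => //; rewrite -derive1E.
Qed.

(* [J] is the Gaussian tail, up to normalization. *)
Lemma gauss_tail : exists J : R -> R,
  [/\ forall x : R, is_derive x 1 J (- g x), forall x, 0 < J x,
      forall x, 0 <= x -> 2 * x * J x <= g x
    & forall x, 0 <= x -> x * g x <= (1 + 2 * x ^+ 2) * J x].
Proof.
have [I dI] := gauss_antiderivative.
have g0 x : 0 < g x by apply: expR_gt0.
have Imono a b : a <= b -> I a <= I b.
  by apply: derive_ge0_mono => // x _; apply: ltW.
have upper x y : x <= y -> 2 * x * (I y - I x) <= g x.
  move=> xy; pose h t := - (2 * x * I t + g t).
  have dh (t : R) : is_derive t 1 h (- (2 * x * g t + - 2 * t * g t)).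
    have := is_derive_gauss t => dg; rewrite /h.
    exact: (is_deriveN (is_deriveD (is_deriveZ (2 * x) (dI t)) dg)).
  have := @derive_ge0_mono h _ x y dh; rewrite /h => /(_ _ xy).
  have xt t : x <= t -> 0 <= - (2 * x * g t + - 2 * t * g t).
    by move=> xt; have := mulr_ge0 (_ : 0 <= t - x) (ltW (g0 t)); rewrite subr_ge0 => /(_ xt); lra.
  move=> /(_ xt); have := g0 y; lra.
(* [h] is chosen to have derivative [2 * (t - x) ^+ 2 * g t]; for [y >= 2 * x] its term
   [(2 * x - y) * g y] is nonpositive and may be dropped. *)
have lower x y : 0 <= x -> 2 * x <= y -> x * g x <= (1 + 2 * x ^+ 2) * (I y - I x).
  move=> x0 xy; pose h t := (2 * x - t) * g t + (1 + 2 * x ^+ 2) * I t.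
  have dh (t : R) : is_derive t 1 h (2 * (t - x) ^+ 2 * g t).
    have := is_derive_gauss t => dg; rewrite /h.
    have d1 : is_derive t 1 (fun t => 2 * x - t) (-1).
      have := is_deriveB (is_derive_cst (2 * x) t 1) (is_derive_id t 1).
      by rewrite sub0r.
    have dd := is_deriveD (is_deriveM d1 dg) (is_deriveZ (1 + 2 * x ^+ 2) (dI t)).
    by apply: (is_derive_eq dd); rewrite /GRing.scale /=; ring.
  have := @derive_ge0_mono h _ x y dh; rewrite /h.
  have xt t : x <= t -> 0 <= 2 * (t - x) ^+ 2 * g t.
    by move=> _; apply: mulr_ge0; [apply: mulr_ge0; rewrite ?sqr_ge0|apply: ltW].
  move=> /(_ xt); have xy' : x <= y by lra.
  move=> /(_ xy'); have := mulr_ge0 (_ : 0 <= y - 2 * x) (ltW (g0 y)).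
  rewrite subr_ge0 => /(_ xy); lra.
pose E := range I.
(* [upper] at [x = 1/2], where the factor [2 * x] is 1, bounds [I] from above; its supremum is then
   its limit at infinity. *)
have half_ub : ubound E (I 2^-1 + g 2^-1).
  move=> _ [y _ <-]; have [yh|/ltW yh] := leP 2^-1 y.
    by have := upper _ _ yh; rewrite mulfV ?mul1r ?pnatr_eq0 //; lra.
  by have := Imono _ _ yh; have := g0 2^-1; lra.
have E0 : has_sup E by split; [exists (I 0); exists 0 | exists (I 2^-1 + g 2^-1)].
pose kappa := sup E.
have kappa_ge y : I y <= kappa.
  by apply: sup_upper_bound => //; exists y.
have kappa_le b : (forall y, I y <= b) -> kappa <= b.
  move=> Ib; apply: ge_sup; first by case: E0.
  by move=> _ [y _ <-].
have lowerJ x : 0 <= x -> x * g x <= (1 + 2 * x ^+ 2) * (kappa - I x).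
  move=> x0; apply: le_trans (lower x (2 * x) x0 (lexx _)) _.
  by rewrite ler_wpM2l ?lerB // addr_ge0 // mulr_ge0 ?sqr_ge0.
exists (fun x => kappa - I x); split=> //.
- by move=> x; have := is_deriveB (is_derive_cst kappa x 1) (dI x); rewrite sub0r.
(* [lowerJ] yields strict positivity only at positive arguments, hence the move to [y >= 1]. *)
- move=> x; set y := Num.max x 1.
  have y1 : 1 <= y by rewrite le_max lexx orbT.
  have xy : x <= y by rewrite le_max lexx.
  apply: (@lt_le_trans _ _ (kappa - I y)); last by have := Imono _ _ xy; lra.
  have := lowerJ y (le_trans ler01 y1); have := mulr_gt0 (lt_le_trans ltr01 y1) (g0 y).
  move=> h1 /(lt_le_trans h1); rewrite pmulr_rgt0 //.
  by rewrite ltr_pwDl // mulr_ge0 ?sqr_ge0.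
- move=> x; rewrite le_eqVlt => /orP[/eqP<-|x0]; first by rewrite mulr0 mul0r ltW.
  suff : kappa - I x <= g x / (2 * x).
    by rewrite ler_pdivlMr ?mulr_gt0 // mulrC.
  rewrite lerBlDl; apply: kappa_le => y; rewrite -lerBlDl.
  rewrite ler_pdivlMr ?mulr_gt0 // mulrC.
  have [xy|/ltW yx] := leP x y; first exact: upper.
  apply: (@le_trans _ _ 0); last exact: ltW.
  by rewrite pmulr_rle0 ?mulr_gt0 // subr_le0; apply: Imono.
Qed.

(* The odd function [f], with [f x = c M(x) - 1] for [x >= 0] and [M] the Mills
   ratio of the Gaussian law, solves Stein's equation for [|x|]. *)
Lemma stein_function : exists (c : R) (f f' : R -> R),
  [/\ 0 < c, forall x, f' x - 2 * x * f x = 2 * `|x| - c,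
      forall x y, `|f (x + y) - f x - f' x * y| <= 2 * y ^+ 2,
      forall x y, `|f' (x + y) - f' x| <= 2 * `|y|
    & forall x, `|f' x| <= c].
Proof.
have [J [dJ J0 Jup Jlow]] := gauss_tail.
pose e x := expR (x ^+ 2) : R; pose M x := J x * e x.
have e0 x : 0 < e x by apply: expR_gt0.
have ge x : g x * e x = 1 by rewrite /gauss_fun /e -expRD addNr expR0.
have de (x : R) : is_derive x 1 e (2 * x * e x).
  have -> : e = expR \o (fun x => x ^+ 2) by [].
  by apply: is_derive_eq; rewrite /e /= /GRing.scale /= !mulr1; ring.
have dM (x : R) : is_derive x 1 M (2 * x * M x - 1).
  have dd := is_deriveM (dJ x) (de x); apply: (is_derive_eq dd).
  by rewrite /GRing.scale /= /M; have := ge x; lra.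
have M0 x : 0 < M x by apply: mulr_gt0.
have Mup (x : R) : 0 <= x -> 2 * x * M x <= 1.
  by move=> x0; rewrite /M mulrA -[leRHS](ge x) ler_pM2r // Jup.
have Mlow (x : R) : 0 <= x -> x <= (1 + 2 * x ^+ 2) * M x.
  move=> x0; apply: (@le_trans _ _ (x * g x * e x)); first by rewrite -mulrA ge mulr1.
  by rewrite /M mulrA ler_pM2r // Jlow.
(* This value, equal to [2 / sqrt pi], gives [p 0 = 0], so that the odd extension is continuous. *)
pose c := (M 0)^-1; have c0 : 0 < c by rewrite invr_gt0.
have cM (x : R) : 0 <= x -> c * M x <= 1.
  move=> x0; rewrite mulrC ler_pdivrMr // mul1r -lerN2.
  pose h t := - M t.
  have dh (t : R) : is_derive t 1 h (- (2 * t * M t - 1)) by apply: is_deriveN.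
  apply: (derive_ge0_mono dh) => // t t0; have := Mup t t0; lra.
pose p x := c * M x - 1; pose dp x := c * (2 * x * M x - 1).
have p_dp (x : R) : is_derive x 1 p (dp x).
  have := is_deriveB (is_deriveZ c (dM x)) (is_derive_cst (1 : R) x 1).
  by rewrite subr0.
have dp_d (x : R) : is_derive x 1 dp (c * (2 * M x + 2 * x * (2 * x * M x - 1))).
  have d2 : is_derive x 1 (fun x : R => 2 * x) 2.
    by have dd := is_deriveZ 2 (is_derive_id x 1); apply: (is_derive_eq dd); rewrite /GRing.scale /= mulr1.
  have dd := is_deriveZ c (is_deriveB (is_deriveM d2 (dM x)) (is_derive_cst (1 : R) x 1)).
  by apply: (is_derive_eq dd); rewrite /GRing.scale /=; ring.
have p0 : p 0 = 0 by rewrite /p mulVf ?subrr // gt_eqF.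
have dp_bound (x : R) : 0 <= x -> `|dp x| <= c.
  move=> x0; rewrite normrM gtr0_norm // -[leRHS]mulr1 ler_pM2l // ler_norml.
  have := Mup x x0; have := mulr_ge0 x0 (ltW (M0 x)) => ? ?; apply/andP; split; lra.
(* The second derivative of [p] is nonnegative by the lower tail bound, and at most
   [2 * c * M x <= 2] by the upper one. *)
have d2p (x : R) : 0 <= x -> `|c * (2 * M x + 2 * x * (2 * x * M x - 1))| <= 2.
  move=> x0; have h1 : 0 <= 2 * M x + 2 * x * (2 * x * M x - 1).
    by have := Mlow x x0; lra.
  rewrite ger0_norm; last by rewrite mulr_ge0 // ltW.
  have h2 : 2 * M x + 2 * x * (2 * x * M x - 1) <= 2 * M x.
    by rewrite gerDl mulr_ge0_le0 ?mulr_ge0 // subr_le0 Mup.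
  apply: le_trans (ler_wpM2l (ltW c0) h2) _; have := cM x x0; lra.
have dp_lip (u v : R) : 0 <= u -> 0 <= v -> `|dp v - dp u| <= 2 * `|v - u|.
  wlog uv : u v / u <= v.
    move=> th u0 v0; have [uv|/ltW vu] := leP u v; first exact: th.
    by rewrite distrC [`|v - u|]distrC; apply: th.
  move=> u0 v0; have [t [ut tv ->]] := mean_value dp_d uv.
  by rewrite normrM ler_wpM2r // d2p // (le_trans u0).
have p_mvt (u v : R) : 0 <= u -> 0 <= v -> exists t : R,
   [/\ 0 <= t, `|t - u| <= `|v - u|, t <= Num.max u v & p v - p u = dp t * (v - u)].
  move=> u0 v0; have [uv|/ltW vu] := leP u v.
    have [t [ut tv e1]] := mean_value p_dp uv; exists t; split=> //; first exact: le_trans ut.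
    by rewrite !ger0_norm ?subr_ge0 ?lerB // (le_trans ut).
  have [t [vt tu e1]] := mean_value p_dp vu; exists t; split=> //; first exact: le_trans vt.
    by rewrite !ler0_norm ?subr_le0 ?lerN2 ?lerB.
  by rewrite -opprB e1 -mulrN opprB.
have p_taylor (u v : R) : 0 <= u -> 0 <= v -> `|p v - p u - dp u * (v - u)| <= 2 * (v - u) ^+ 2.
  move=> u0 v0; have [t [t0 tu _ ->]] := p_mvt _ _ u0 v0.
  rewrite -mulrBl normrM -[(v - u) ^+ 2]real_normK ?num_real // expr2 mulrA ler_wpM2r //.
  by apply: le_trans (dp_lip _ _ u0 t0) _; rewrite ler_pM2l.
(* Taylor's bound across the origin, from [u] to [- v], where the odd extension equals [- p v]. *)
have p_cross (u v : R) : 0 <= u -> 0 <= v ->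
    `|p v + p u - dp u * (v + u)| <= 2 * (v + u) ^+ 2.
  move=> u0 v0; have [t [t0 _ tv]] := p_mvt _ _ (lexx 0) v0.
  have [s [s0 _ su]] := p_mvt _ _ (lexx 0) u0.
  rewrite p0 !subr0 => -> ->.
  have -> : dp t * v + dp s * u - dp u * (v + u) = (dp t - dp u) * v + (dp s - dp u) * u by ring.
  apply: le_trans (ler_normD _ _) _; rewrite !normrM !(@ger0_norm _ u) // !(@ger0_norm _ v) //.
  have -> : 2 * (v + u) ^+ 2 = 2 * (v + u) * v + 2 * (v + u) * u by ring.
  have near r : 0 <= r -> r <= Num.max 0 v \/ r <= Num.max 0 u -> `|r - u| <= v + u.
    move=> r0; rewrite !max_r // ler_norml => -[] ?; apply/andP; split; lra.
  apply: lerD; rewrite ler_wpM2r //.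
    by apply: le_trans (dp_lip _ _ u0 t0) _; rewrite ler_pM2l // near //; left.
  by apply: le_trans (dp_lip _ _ u0 s0) _; rewrite ler_pM2l // near //; right.
pose f (x : R) := if 0 <= x then p x else - p (- x); pose f' (x : R) := dp `|x|.
exists c, f, f'; split=> //.
- move=> x; rewrite /f /f' /p /dp; case: (lerP 0 x) => x0.
    by rewrite ger0_norm //; ring.
  by rewrite ltr0_norm //; ring.
- move=> x y; rewrite /f /f'; case: (lerP 0 x) => x0; rewrite ?(ger0_norm x0) ?(ltr0_norm x0);
    case: (lerP 0 (x + y)) => xy0.
  + by have := p_taylor _ _ x0 xy0; rewrite (addrC x y) addrK.
  + have v0 : 0 <= - (x + y) by lra.
    have := p_cross _ _ x0 v0; rewrite -normrN.
    have -> : - (x + y) + x = - y by ring.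
    by rewrite sqrrN; congr (`|_| <= _); ring.
  + have u0 : 0 <= - x by lra.
    have := p_cross _ _ u0 xy0.
    have -> : x + y + - x = y by ring.
    by congr (`|_| <= _); ring.
  + have u0 : 0 <= - x by lra. have v0 : 0 <= - (x + y) by lra.
    have := p_taylor _ _ u0 v0; rewrite -normrN.
    have -> : - (x + y) - - x = - y by ring.
    by rewrite sqrrN; congr (`|_| <= _); ring.
- move=> x y; rewrite /f'; apply: le_trans (dp_lip _ _ _ _) _ => //.
  by rewrite ler_pM2l //; have := ler_dist_dist (x + y) x; rewrite [x + y]addrC addrK.
- by move=> x; apply: dp_bound.
Qed.

End SteinFunction.

(** * Moments of additive functionals *)

Section AdditiveFunctional.
Variables (R : realType) (Sigma S : finType) (c0 : Sigma) (step : S -> Sigma -> S).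
Variables (w0 : seq Sigma) (Fs : S).
Hypothesis sync : forall F, foldl step F w0 = Fs.
Local Notation expect := (@expect R _).
Local Notation P u F := (expect (fun c => u (step F c))).

Section Stationary.
Variable pi : {ffun S -> R}.
Hypotheses (pi_ge0 : forall F, 0 <= pi F) (pi_sum1 : \sum_F pi F = 1).
Hypothesis poisson : forall g : S -> R, exists u : S -> R, forall F,
  g F - \sum_G pi G * g G = u F - P u F.

(** Apply [P] to Poisson's equation for [u] and subtract it from the equation for [P u]: the
    difference of the two means becomes a constant of the form [w - P w], hence 0. *)
Lemma stationary_mean (u : S -> R) : \sum_F pi F * P u F = \sum_F pi F * u F.
Proof.
have [u1 u1E] := poisson u; have [u2 u2E] := poisson (fun F => P u F).
pose a := \sum_F pi F * P u F - \sum_F pi F * u F.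
have [F|a0 _] := superharmonic_const c0 sync (u := fun F => P u1 F - u2 F) (a := a).
  rewrite expectD expectN.
  have := u2E F; have -> : expect (fun c => P u1 (step F c)) =
      P u1 F - P u F + \sum_G pi G * u G.
    rewrite -expectN -expectD -[X in _ + X](expect_cst c0) -expectD.
    by apply: eq_expect => c; have := u1E (step F c); lra.
  by rewrite /a; lra.
by apply/eqP; rewrite -subr_eq0 -/a a0.
Qed.

Lemma stationary_step F c : 0 < pi F -> 0 < pi (step F c).
Proof.
move=> piF; have := stationary_mean (fun G => (G == step F c)%:R).
rewrite [RHS](bigD1 (step F c)) //= eqxx mulr1 [in RHS]big1 => [|G /negPf->]; last by rewrite mulr0.
rewrite addr0 => <-; rewrite (bigD1 F) //= ltr_pwDl ?sumr_ge0 //.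
  apply: mulr_gt0 => //; rewrite divr_gt0 ?card_gt0R //.
  by rewrite (bigD1 c) //= eqxx ltr_pwDl // sumr_ge0.
move=> G _; rewrite mulr_ge0 // divr_ge0 // sumr_ge0 //.
Qed.

Lemma stationary_word F w : 0 < pi F -> 0 < pi (foldl step F w).
Proof. by elim: w F => //= c w IH F piF; apply/IH/stationary_step. Qed.

Lemma stationary_sync : 0 < pi Fs.
Proof.
have [/existsP[F piF]|] := boolP [exists F, 0 < pi F].
  by rewrite -(sync F) stationary_word.
move=> /existsPn pi0; have := pi_sum1; rewrite big1 => [/esym/eqP|F _].
  by rewrite oner_eq0.
by apply/eqP; rewrite eq_le pi_ge0 leNgt pi0.
Qed.

(** The increments vanish at every state of positive mass, and words starting from [Fs] visit only
    such states. *)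
Lemma null_variance (d : S -> Sigma -> R) :
  \sum_F pi F * expect (fun c => d F c ^+ 2) = 0 -> forall w, path_sum step d Fs w = 0.
Proof.
have sq_ge0 F : 0 <= expect (fun c => d F c ^+ 2).
  by rewrite divr_ge0 // sumr_ge0 // => c _; apply: sqr_ge0.
have term_ge0 F : 0 <= pi F * expect (fun c => d F c ^+ 2) by rewrite mulr_ge0.
move=> s0; have d0 F c : 0 < pi F -> d F c = 0.
  move=> piF; have /eqP : pi F * expect (fun c => d F c ^+ 2) = 0.
    apply/eqP; rewrite eq_le term_ge0 andbT -s0 (bigD1 F) //= lerDl sumr_ge0 //.
  rewrite mulf_eq0 gt_eqF //= => /eqP E0.
  have := expect_eq_max c0 (f := fun c => - d F c ^+ 2) (a := 0).
  rewrite expectN E0 oppr0 => /(_ _ erefl c) h; apply/eqP.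
  rewrite -sqrf_eq0 -oppr_eq0 h // => c'; rewrite oppr_le0; exact: sqr_ge0.
move=> w; have := stationary_sync; elim: w Fs => //= c w IH F piF.
by rewrite d0 // IH ?addr0 //; apply: stationary_step.
Qed.

End Stationary.

Lemma path_sumD (g h : S -> Sigma -> R) F w :
  path_sum step (fun F c => g F c + h F c) F w = path_sum step g F w + path_sum step h F w.
Proof. by elim: w F => [|c w IH] F /=; rewrite ?addr0 // IH addrACA. Qed.

Lemma path_sum_coboundary (u : S -> R) a F w :
  path_sum step (fun F c => u (step F c) - u F - a) F w =
  u (foldl step F w) - u F - a * (size w)%:R.
Proof.
elim: w F => [|c w IH] F /=; first by rewrite subrr mulr0 subr0.
by rewrite IH -natr1; ring.
Qed.

Variable g : S -> Sigma -> R.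
Local Notation D := (path_sum step g).

(** The coboundary of [u] makes the increments [g] centred, giving [d]; that of [h] does the same
    for [d ^+ 2], giving [e]. Both telescope to bounded terms. If [a = 0] then [v = 0], so the
    martingale vanishes along all words from [Fs] and only the coboundary is left. *)
Lemma additive_functional : exists (s a C : R),
  [/\ 0 <= a, 0 <= C /\ (forall F n, `|word_mean n (D F) - s * n%:R| <= C),
   forall n, word_mean n (fun w => (D Fs w - s * n%:R) ^+ 2) <= C * n.+1%:R,
   forall n, `|word_mean n (fun w => `|D Fs w - s * n%:R|) - a * Num.sqrt n%:R| <= C
   & a = 0 -> exists u : S -> R, forall w,
       D Fs w = s * (size w)%:R + u Fs - u (foldl step Fs w)].
Proof.
have [pi [pi_ge0 pi_sum1 poisson]] := stationary_law R c0 sync.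
have [u uE] := poisson (fun F => expect (g F)).
set s := \sum_G _ in uE.
pose d F c := g F c + (u (step F c) - u F - s).
have d_centered F : expect (d F) = 0.
  rewrite expectD [X in _ + X](eq_expect (fun c => esym (addrA _ _ _))) expectD expect_cst //.
  by have := uE F; lra.
have dE F w : path_sum step d F w = D F w + (u (foldl step F w) - u F - s * (size w)%:R).
  by rewrite path_sumD path_sum_coboundary.
have [h hE] := poisson (fun F => expect (fun c => d F c ^+ 2)).
set v := \sum_G _ in hE.
pose e F c := d F c ^+ 2 + (h (step F c) - h F - v).
have e_centered F : expect (e F) = 0.
  rewrite expectD [X in _ + X](eq_expect (fun c => esym (addrA _ _ _))) expectD expect_cst //.
  by have := hE F; lra.
have eE F w : path_sum step (fun F c => d F c ^+ 2) F w =
    path_sum step e F w + v * (size w)%:R - (h (foldl step F w) - h F).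
  by rewrite [path_sum _ e _ _]path_sumD path_sum_coboundary; ring.
have v0 : 0 <= v.
  apply: sumr_ge0 => F _; rewrite mulr_ge0 // divr_ge0 // sumr_ge0 // => c _; exact: sqr_ge0.
have [K K0 dK] := finite_bound d; have [E E0 eK] := finite_bound e.
have [U U0 uU'] := finite_bound (fun F (_ : Sigma) => u F).
have [H H0 hH'] := finite_bound (fun F (_ : Sigma) => h F).
have uU F : `|u F| <= U := uU' F c0; have hH F : `|h F| <= H := hH' F c0.
have [V V0 mV] := mismatches_bounded R c0 sync.
have near_d F w : `|(D F w - s * (size w)%:R) - path_sum step d F w| <= 2 * U.
  rewrite dE; have := uU F; have := uU (foldl step F w); rewrite !ler_norml.
  by move=> /andP[? ?] /andP[? ?]; apply/andP; split; lra.
have [c [f [f' [cgt0 steinE taylor lip bound]]]] := stein_function R.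
(* With [c = 2 / sqrt pi] this is [sqrt (2 v / pi)], the first absolute moment of the centred
   Gaussian law of variance [v]. *)
pose a := Num.sqrt (2 * v) * c / 2.
have a0 : 0 <= a by rewrite divr_ge0 // mulr_ge0 ?sqrtr_ge0 // ltW.
have [C3 C30 absA] : exists2 C3, 0 <= C3 & forall n,
    `|word_mean n (fun w => `|path_sum step d Fs w|) - a * Num.sqrt n%:R| <= C3.
  have [v_eq0|v_neq0] := eqVneq v 0.
    exists 0 => // n; have A0 := null_variance pi_ge0 pi_sum1 poisson v_eq0.
    rewrite (@eq_word_mean _ _ _ _ (fun=> 0)) => [|w]; last by rewrite A0 normr0.
    by rewrite word_mean_cst // /a v_eq0 mulr0 sqrtr0 !mul0r subrr normr0.
  have vgt0 : 0 < v by rewrite lt_neqAle eq_sym v_neq0.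
  pose C1 := K ^+ 2 + 2 * K ^+ 2 * V.
  pose C2 := K * (2 * C1 * V + K ^+ 2 + K ^+ 2).
  pose C2' := E * (K + 2 * K * V).
  have C10 : 0 <= C1 by rewrite addr_ge0 ?mulr_ge0 ?exprn_ge0.
  have C20 : 0 <= C2 by rewrite mulr_ge0 // !addr_ge0 ?mulr_ge0 ?exprn_ge0.
  have C20' : 0 <= C2' by rewrite mulr_ge0 // addr_ge0 // !mulr_ge0.
  exists ((C2 + C2') / v + 2 * H * (c / Num.sqrt (2 * v))).
    by rewrite addr_ge0 ?divr_ge0 ?mulr_ge0 ?addr_ge0 ?invr_ge0 ?sqrtr_ge0 // ltW.
  move=> n; have [->|n0] := posnP n.
    rewrite /= sqrtr0 mulr0 normr0 subrr normr0.
    by rewrite addr_ge0 ?divr_ge0 ?mulr_ge0 ?addr_ge0 ?invr_ge0 ?sqrtr_ge0 // ltW.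
  have nR : 1 <= n%:R :> R by rewrite ler1n.
  have n0R : 0 < n%:R :> R by rewrite ltr0n.
  (* The density proportional to [exp (- x^2)] has variance 1/2, so [q ^+ 2 / 2] must match the
     variance [v n]. The rescaled test function then has second-order constant
     [2 / q ^+ 2 = O(1/n)]. *)
  pose q := Num.sqrt (2 * v * n%:R) : R.
  have q0 : 0 < q by rewrite sqrtr_gt0 !mulr_gt0.
  have qq : q ^+ 2 = 2 * v * n%:R by rewrite sqr_sqrtr // !mulr_ge0.
  have qE : q = Num.sqrt (2 * v) * Num.sqrt n%:R by rewrite -sqrtrM // mulr_ge0.
  pose ft x := f (x / q); pose ft' x := f' (x / q) / q.
  have t1 x y : `|ft (x + y) - ft x - ft' x * y| <= 2 / q ^+ 2 * y ^+ 2.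
    have := taylor (x / q) (y / q); rewrite -mulrDl /ft /ft'.
    have -> : f' (x / q) / q * y = f' (x / q) * (y / q) by ring.
    by have -> : 2 / q ^+ 2 * y ^+ 2 = 2 * (y / q) ^+ 2 by field; rewrite gt_eqF.
  have t2 x y : `|ft' (x + y) - ft' x| <= 2 / q ^+ 2 * `|y|.
    rewrite /ft' -mulrBl normrM normfV (gtr0_norm q0) ler_pdivrMr // mulrDl.
    apply: le_trans (lip _ _) _; rewrite normrM normfV (gtr0_norm q0).
    by rewrite le_eqVlt; apply/orP; left; apply/eqP; field; rewrite gt_eqF.
  have t3 x : `|ft' x| <= c / q.
    by rewrite /ft' normrM normfV (gtr0_norm q0) ler_pM2r ?invr_gt0.
  have S1 := stein_expansion c0 d_centered K0 dK V0 mV t1 t2 n Fs 0.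
  have S2 := compensator_mean c0 K0 dK mV t2 e_centered n Fs 0 E0 eK.
  set M1 := word_mean n _ in S1; set M2 := word_mean n _ in S1.
  set M3 := word_mean n _ in S2.
  pose M4 := word_mean n (fun w => ft' (path_sum step d Fs w)).
  have S3 : `|M2 - (M3 + v * n%:R * M4)| <= 2 * H * (c / q).
    rewrite /M2 /M3 /M4 -word_meanZ -word_meanD; apply: word_mean_near => // w sw.
    rewrite eE sw add0r.
    have -> : (path_sum step e Fs w + v * n%:R - (h (foldl step Fs w) - h Fs)) *
      ft' (path_sum step d Fs w) - (path_sum step e Fs w * ft' (path_sum step d Fs w) +
      v * n%:R * ft' (path_sum step d Fs w)) =
      - (h (foldl step Fs w) - h Fs) * ft' (path_sum step d Fs w) by ring.
    rewrite normrM normrN; apply: ler_pM => //.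
    by apply: le_trans (ler_normB _ _) _; rewrite mulrDl mul1r lerD.
  (* Stein's equation at [x / q], multiplied by [- q / 2]. *)
  have S4 : M1 - v * n%:R * M4 = - (word_mean n (fun w => `|path_sum step d Fs w|) - a * Num.sqrt n%:R).
    rewrite /M1 /M4 -word_meanZ -word_meanB -[a * _](word_mean_cst c0 n) -word_meanB -word_meanN.
    apply: eq_word_mean => w; rewrite add0r; set x := path_sum step d Fs w.
    have := steinE (x / q); rewrite normrM normfV (gtr0_norm q0) => e1.
    have e2 : a * Num.sqrt n%:R = q * c / 2 by rewrite qE /a; ring.
    have e3 : v * n%:R = q ^+ 2 / 2 by rewrite qq; field.
    rewrite e2 e3 /ft /ft'.
    have qn : q != 0 by rewrite gt_eqF.
    have -> : f' (x / q) = 2 * (`|x| / q) - c + 2 * (x / q) * f (x / q) by rewrite -e1; ring.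
    by field.
  rewrite -normrN -S4.
  have -> : M1 - v * n%:R * M4 = (M1 - M2) + M3 + (M2 - (M3 + v * n%:R * M4)) by ring.
  apply: le_trans (ler_normD _ _) _; apply: lerD; last first.
    apply: le_trans S3 _; rewrite ler_wpM2l ?mulr_ge0 // ler_pM2l // lef_pV2 ?posrE //.
      rewrite ler_wsqrtr // ler_peMr // mulr_ge0 //.
    by rewrite sqrtr_gt0 mulr_gt0.
  apply: le_trans (ler_normD _ _) _; rewrite mulrDl; apply: lerD.
    apply: le_trans S1 _; rewrite -/C1 -/C2 qq; have nn : n%:R != 0 :> R by rewrite gt_eqF.
    by rewrite le_eqVlt; apply/orP; left; apply/eqP; field; rewrite v_neq0.
  apply: le_trans S2 _; rewrite qq; have nn : n%:R != 0 :> R by rewrite gt_eqF.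
  by rewrite le_eqVlt /C2'; apply/orP; left; apply/eqP; field; rewrite v_neq0.
have mart := martingale_mean step d_centered.
have var n := martingale_variance c0 step d_centered n Fs dK.
(* [8 * U ^+ 2] and [2 * K ^+ 2] come from [y^2 <= 2 x^2 + 2 (y - x)^2] with [|y - x| <= 2 U]. *)
pose C := 2 * U + C3 + 8 * U ^+ 2 + 2 * K ^+ 2.
have U20 := sqr_ge0 U; have K20 := sqr_ge0 K.
exists s, a, C; split=> //.
- split; first by rewrite /C; lra.
  move=> F n; apply: (@le_trans _ _ (2 * U)); last by rewrite /C; lra.
  rewrite -[s * _](word_mean_cst c0 n) -word_meanB -[X in `|X|]subr0 -(mart n F).
  by apply: word_mean_near => // w <-; apply: near_d.
- move=> n; apply: (@le_trans _ _ (word_mean n (fun w => 8 * U ^+ 2 + 2 * path_sum step d Fs w ^+ 2))).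
    apply: word_mean_le => // w <-; have := near_d Fs w.
    set x := path_sum _ d _ _; set y := D _ _ - _ => yx.
    have : (y - x) ^+ 2 <= (2 * U) ^+ 2.
      by rewrite -[leLHS]real_normK ?num_real // ler_pXn2r ?nnegrE ?mulr_ge0.
    have := sqr_ge0 (y - 2 * x); lra.
  rewrite word_meanD word_meanZ word_mean_cst // -natr1 /C.
  have := var n; have := mulr_ge0 U0 (ler0n R n); have := mulr_ge0 C30 (ler0n R n).
  have := mulr_ge0 U20 (ler0n R n); have := mulr_ge0 K20 (ler0n R n); lra.
- move=> n; apply: (@le_trans _ _ (2 * U + C3)); last by rewrite /C; lra.
  set A := a * _; pose m := word_mean n (fun w => `|path_sum step d Fs w|).
  have -> : forall z, z - A = (z - m) + (m - A) by move=> z; ring.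
  apply: le_trans (ler_normD _ _) _; apply: lerD; last exact: absA.
  apply: word_mean_near => // w <-; apply: le_trans (ler_dist_dist _ _) _; exact: near_d.
- move=> aE; have v_eq0 : v = 0.
    apply/eqP; rewrite eq_le v0 andbT leNgt; apply/negP => vgt0.
    by move: aE; rewrite /a => /eqP; rewrite gt_eqF // divr_gt0 // mulr_gt0 // sqrtr_gt0 mulr_gt0.
  exists u => w; have := null_variance pi_ge0 pi_sum1 poisson v_eq0 w.
  by rewrite dE; lra.
Qed.

End AdditiveFunctional.

(** * Asymptotics *)

Section Asymptotics.
Variable R : realType.

Lemma cvg_of_bounded_error (e : nat -> R) s C : (forall n, `|e n - s * n%:R| <= C) ->
  e n / n%:R @[n --> \oo] --> s.
Proof.
move=> eC; apply/cvgrPdist_le => eps eps0; near=> n.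
have n0 : 0 < n%:R :> R by rewrite ltr0n; near: n; exact: nbhs_infty_gt.
have nC : C / eps <= n%:R by near: n; apply: nbhs_infty_ger.
have -> : s - e n / n%:R = - (e n - s * n%:R) / n%:R by field; rewrite gt_eqF.
rewrite normrM normrN normfV (gtr0_norm n0) ler_pdivrMr // (le_trans (eC n)) //.
by rewrite mulrC -ler_pdivrMr.
Unshelve. all: by end_near. Qed.

(** This gives uniqueness of [gamma] and [tau]. Along the squares [n = j^2] the bound reads
    [|x j - y| j <= C], which forces first [x = 0], then [y = 0]. *)
Lemma bounded_linear_sqrt (x y C : R) :
  (\forall n \near \oo, `|x * n%:R - y * Num.sqrt n%:R| <= C) -> x = 0 /\ y = 0.
Proof.
case=> N _ Nle.
have C0 : 0 <= C by apply: le_trans (Nle N _) => //=.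
have sq j : (N <= j)%N -> `|x * j%:R - y| * j%:R <= C.
  move=> Nj; have /= := Nle (j ^ 2)%N; have jj : (N <= j ^ 2)%N.
    by apply: leq_trans Nj _; case: (j) => // j'; rewrite expnS expn1 leq_pmulr.
  move=> /(_ jj); rewrite natrX sqrtr_sqr (ger0_norm (ler0n R j)).
  have -> : x * j%:R ^+ 2 - y * j%:R = (x * j%:R - y) * j%:R by ring.
  by rewrite normrM (ger0_norm (ler0n _ _)).
have large (b : R) : exists j, (N <= j)%N /\ b <= j%:R.
  exists (maxn N (Num.truncn b).+1); rewrite leq_maxl; split=> //.
  apply: le_trans (ltW (truncnS_gt b)) _; rewrite ler_nat leq_maxr //.
have x0 : x = 0.
  apply/eqP/negPn/negP => xN; have xgt : 0 < `|x| by rewrite normr_gt0.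
  have [j [Nj bj]] := large ((`|y| + C + 1) / `|x| + 1).
  have j1 : 1 <= j%:R :> R.
    by apply: le_trans bj; rewrite lerDr divr_ge0 // !addr_ge0.
  have := sq j Nj; apply/negP; rewrite -ltNge.
  have h1 : `|y| + C + 1 <= `|x| * j%:R.
    have : (`|y| + C + 1) / `|x| <= j%:R by lra.
    by rewrite ler_pdivrMr // mulrC.
  have h2 : `|x| * j%:R - `|y| <= `|x * j%:R - y|.
    by have := lerB_dist (x * j%:R) y; rewrite normrM (ger0_norm (ler0n _ _)).
  have h3 : C + 1 <= `|x * j%:R - y| by lra.
  apply: (@lt_le_trans _ _ (C + 1)); first by rewrite ltrDl.
  by apply: le_trans h3 _; rewrite ler_peMr.
split=> //; apply/eqP/negPn/negP => yN; have ygt : 0 < `|y| by rewrite normr_gt0.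
have [j [Nj bj]] := large ((C + 1) / `|y|).
have := sq j Nj; rewrite x0 mul0r sub0r normrN; apply/negP; rewrite -ltNge.
by move: bj; rewrite ler_pdivrMr // mulrC; lra.
Qed.

Section PositivePart.
Variables (Sigma : finType) (c0 : Sigma) (D : seq Sigma -> R) (s a C : R).
Hypothesis C0 : 0 <= C.
Hypothesis mean_D : forall n, `|word_mean n D - s * n%:R| <= C.
Hypothesis var_D : forall n, word_mean n (fun w => (D w - s * n%:R) ^+ 2) <= C * n.+1%:R.
Hypothesis abs_D : forall n,
  `|word_mean n (fun w => `|D w - s * n%:R|) - a * Num.sqrt n%:R| <= C.

(* [max(y - b, 0) <= y^2 / (4 b)] *)
Lemma positive_part_tail (sgn b : R) n : `|sgn| = 1 -> 0 < b -> (0 < n)%N ->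
  word_mean n (fun w => Num.max (sgn * (D w - s * n%:R) - b * n%:R) 0) <= C / (2 * b).
Proof.
move=> sgn1 b0 n0; have nR : 0 < n%:R :> R by rewrite ltr0n.
apply: (@le_trans _ _ (word_mean n (fun w => (4 * b * n%:R)^-1 * (D w - s * n%:R) ^+ 2))).
  apply: word_mean_le => // w _; set y := D w - _.
  have -> : y ^+ 2 = (sgn * y) ^+ 2.
    by rewrite exprMn -(@real_normK _ sgn) ?num_real // sgn1 expr1n mul1r.
  rewrite [leRHS]mulrC ler_pdivlMr ?mulr_gt0 // maxr_pMl; last by rewrite !mulr_ge0 // ltW.
  rewrite mul0r ge_max sqr_ge0 andbT.
  have := sqr_ge0 (sgn * y - 2 * b * n%:R); lra.
rewrite word_meanZ mulrC ler_pdivrMr ?mulr_gt0 //.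
apply: le_trans (var_D n) _.
have -> : C / (2 * b) * (4 * b * n%:R) = C * (2 * n%:R) by field; rewrite gt_eqF.
by rewrite ler_wpM2l // -natrM ler_nat; lia.
Qed.

(** For [s < rho] write [x^+ = x + (- x)^+], where the last part is a tail beyond [(rho - s) n]; for
    [s > rho] the whole is such a tail; for [s = rho] write [x^+ = (|x| + x) / 2], the origin of
    [a / 2]. *)
Lemma mean_positive_part rho : exists C', forall n, (0 < n)%N ->
  `|word_mean n (fun w => Num.max (rho * n%:R - D w) 0) -
    ((if s <= rho then rho - s else 0) * n%:R +
     (if s == rho then a / 2 else 0) * Num.sqrt n%:R)| <= C'.
Proof.
have [srho|rhos|srho] := ltgtP s rho.
- have b0 : 0 < rho - s by rewrite subr_gt0.
  exists (C + C / (2 * (rho - s))) => n n0.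
  have := positive_part_tail (normr1 R) b0 n0; set T := word_mean n _ => TC.
  have T0 : 0 <= T.
    by rewrite -(word_mean_cst c0 n 0); apply: word_mean_le => // w _; rewrite le_max lexx orbT.
  have -> : word_mean n (fun w => Num.max (rho * n%:R - D w) 0) =
      (rho - s) * n%:R - (word_mean n D - s * n%:R) + T.
    rewrite -[(rho - s) * _](word_mean_cst c0 n) -[s * _](word_mean_cst c0 n) -!word_meanB /T -word_meanD.
    apply: eq_word_mean => w.
    by rewrite /Num.max; case: ifP; case: ifP; lra.
  rewrite mul0r addr0; have := mean_D n; set Y := word_mean n D - _.
  rewrite !ler_norml => /andP[? ?]; apply/andP; split; lra.
- have b0 : 0 < s - rho by rewrite subr_gt0.
  exists (C / (2 * (s - rho))) => n n0.
  have := positive_part_tail (normrN1 R) b0 n0; set T := word_mean n _ => TC.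
  have T0 : 0 <= T.
    by rewrite -(word_mean_cst c0 n 0); apply: word_mean_le => // w _; rewrite le_max lexx orbT.
  have -> : word_mean n (fun w => Num.max (rho * n%:R - D w) 0) = T.
    by apply: eq_word_mean => w; congr Num.max; ring.
  by rewrite !mul0r addr0 subr0 ger0_norm.
- exists C => n _; rewrite -srho subrr mul0r add0r.
  have -> : word_mean n (fun w => Num.max (s * n%:R - D w) 0) =
      2^-1 * (word_mean n (fun w => `|D w - s * n%:R|) - (word_mean n D - s * n%:R)).
    rewrite -[s * n%:R in X in _ = X](word_mean_cst c0 n) -!word_meanB -word_meanZ.
    apply: eq_word_mean => w; rewrite word_mean_cst //.
    by have [h|h] := lerP 0 (D w - s * n%:R); rewrite ?(ger0_norm h) ?(ltr0_norm h) /Num.max;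
      case: ifP => h'; lra.
  have := mean_D n; have := abs_D n.
  rewrite !ler_norml => /andP[? ?] /andP[? ?]; apply/andP; split; lra.
Qed.

End PositivePart.

End Asymptotics.

(** * Application to the frogs *)

Section FrogAsymptotics.
Variables (R : realType) (Sigma : finType) (k : nat) (k0 : (0 < k)%N) (W : k.-tuple Sigma).
Hypothesis irr : ~ reducible_word W.
Local Notation move := (frog_move W).
Local Notation c0 := (tnth W (pad k0 0)).
Local Notation disp m := (fun F c => (displacement1 W F c m)%:R : R).

Lemma path_sum_displacement F w m :
  path_sum move (disp m) F w = (total_displacement W F w m)%:R.
Proof. by elim: w F => //= c w IH F; rewrite IH natrD. Qed.

Lemma expected_displacementE F m n :
  expected_displacement R W F m n = word_mean n (path_sum move (disp m) F).
Proof.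
rewrite -expect_tuple; apply: eq_expect => r.
by rewrite path_sum_displacement displacementE.
Qed.

(** For uniqueness, integrate Poisson's equation for the indicator of [G] against another stationary
    law: the right side vanishes. *)
Lemma frog_stationary_unique : exists! pi : {ffun arrangement k -> R}, frog_stationary W pi.
Proof.
have [w0 sync] := synchronizing_word k0 irr.
have [pi [pi0 pi1 poisson]] := stationary_law R c0 sync.
exists pi; split.
  split=> // G; rewrite (stationary_mean c0 sync poisson (fun F => (F == G)%:R)).
  rewrite (bigD1 G) //= eqxx mulr1 big1 ?addr0 // => F /negPf->.
  by rewrite mulr0.
move=> pi' [pi'0 pi'1 pi'S]; apply/ffunP => G.
have [u uE] := poisson (fun F => (F == G)%:R).
have piG (p : {ffun arrangement k -> R}) : \sum_F p F * (F == G)%:R = p G.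
  rewrite (bigD1 G) //= eqxx mulr1 big1 ?addr0 // => F /negPf->.
  by rewrite mulr0.
have invar : \sum_F pi' F * expect (fun c => u (move F c)) = \sum_F pi' F * u F.
  transitivity (\sum_F \sum_H pi' F * frog_transition R W F H * u H).
    apply: eq_bigr => F _; under eq_bigr do rewrite -mulrA.
    rewrite -mulr_sumr; congr (_ * _); rewrite /frog_transition /expect.
    under [RHS]eq_bigr do rewrite mulrAC mulr_suml.
    rewrite -[RHS]mulr_suml exchange_big /=; congr (_ / _); apply: eq_bigr => c _.
    rewrite (bigD1 (move F c)) //= eqxx mul1r big1 ?addr0 // => H.
    by rewrite eq_sym => /negPf->; rewrite mul0r.
  rewrite exchange_big; apply: eq_bigr => H _; rewrite -mulr_suml.
  by rewrite pi'S.
have : \sum_F pi' F * ((F == G)%:R - pi G) = 0.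
  rewrite -[pi G]piG; under eq_bigr do rewrite uE mulrBr.
  by rewrite sumrB invar subrr.
under eq_bigr do rewrite mulrBr.
by rewrite sumrB piG -mulr_suml pi'1 mul1r => /eqP; rewrite subr_eq0 => /eqP.
Qed.

Lemma lcs_positive_parts (rho : R) n w : 0 <= rho ->
  `|(lcs w (periodic_word W (Num.truncn (rho * n%:R))))%:R -
    (rho * n%:R - k%:R^-1 * \sum_(m < k) Num.max (rho * n%:R - path_sum move (disp m) 1%g w) 0)|
  <= 1 + 3 * k%:R.
Proof.
move=> rho0; have x0 : 0 <= rho * n%:R by rewrite mulr_ge0.
set N := Num.truncn _; have /andP[Nle Nlt] := truncn_itv x0; rewrite -/N in Nle Nlt.
have kR : 1 <= k%:R :> R by rewrite ler1n.
have := lcs_trails k0 W w N; move=> /(congr1 (fun n => n%:R : R)); rewrite natrD natr_sum => lcsE.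
(* After multiplication by [k], three errors of at most [k] each: rounding in [trail], the starting
   pad [m < k], and the integer part [N]. *)
have trail_near m : `|(trail k (position W w m) N)%:R -
    k%:R^-1 * Num.max (rho * n%:R - path_sum move (disp m) 1%g w) 0| <= 3.
  rewrite path_sum_displacement; set X := position W w m; set d := total_displacement _ _ _ _.
  have XE : X = (m + d)%N by [].
  have /andP[lo hi] := trail_bounds k0 X N.
  have mk : (m%:R : R) <= k%:R by rewrite ler_nat ltnW.
  have m0 : 0 <= m%:R :> R by [].
  have kgt0 : 0 < k%:R :> R by apply: lt_le_trans kR.
  set mx := Num.max _ _.
  have -> : (trail k X N)%:R - k%:R^-1 * mx = ((trail k X N * k)%:R - mx) / k%:R.
    by rewrite natrM; field; rewrite gt_eqF.
  rewrite normrM normfV (gtr0_norm kgt0) ler_pdivrMr //.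
  have lo' : (N%:R : R) <= X%:R + (trail k X N * k)%:R by rewrite -natrD ler_nat; lia.
  have t0 : 0 <= (trail k X N * k)%:R :> R by [].
  have hi' : (trail k X N * k)%:R <= k%:R :> R \/
      (trail k X N * k)%:R + X%:R <= N%:R + k%:R :> R.
    by have [XN|NX] := leqP X N; [right|left]; rewrite -?natrD ler_nat; lia.
  rewrite XE natrD in lo' hi'; rewrite -natr1 in Nlt.
  rewrite /mx /Num.max ler_norml; case: ifP => h; apply/andP; split; case: hi'; lra.
have -> : (lcs w (periodic_word W N))%:R - (rho * n%:R - k%:R^-1 *
    \sum_(m < k) Num.max (rho * n%:R - path_sum move (disp m) 1%g w) 0) =
    (N%:R - rho * n%:R) - \sum_(m < k) ((trail k (position W w m) N)%:R -
    k%:R^-1 * Num.max (rho * n%:R - path_sum move (disp m) 1%g w) 0).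
  by rewrite sumrB -mulr_sumr; lra.
apply: le_trans (ler_normB _ _) _; apply: lerD.
  by rewrite -natr1 in Nlt; rewrite ler_norml; apply/andP; split; lra.
apply: le_trans (ler_norm_sum _ _ _) _.
apply: le_trans (ler_sum _ (fun m _ => trail_near m)) _.
by rewrite sumr_const card_ord mulr_natr.
Qed.

(* On [W] itself every frog moves at speed one from [1], so a coboundary would
   force every cycle through [1] to have speed one. *)
Lemma displacement_not_coboundary (m : 'I_k) (s : R) (u : arrangement k -> R) :
  (1 < #|Sigma|)%N ->
  ~ (forall w, path_sum move (disp m) 1%g w =
       s * (size w)%:R + u 1%g - u (foldl move 1%g w)).
Proof.
move=> Sigma2 cob.
have kN : k%:R != 0 :> R by rewrite pnatr_eq0 -lt0n.
have s1 : s = 1.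
  have := cob (periodic_word W k); rewrite path_sum_displacement.
  rewrite (run1_period k0 W) (run1_displacement k0) (size_periodic_word k0).
  by move=> e; apply: (mulIf kN); rewrite mul1r; lra.
have [v [r [cyc off]]] := off_speed_cycle k0 W 1%g m Sigma2.
apply: off; apply/eqP; rewrite -(eqr_nat R); apply/eqP.
have := cob (v ++ r); have := cob v.
rewrite !path_sum_displacement total_displacement_cat cyc size_cat !natrD s1; lra.
Qed.

(** With a single letter the displacement is deterministic and [a m = 0], hence the condition on the
    alphabet. The synchronizing word ends at the identity, the arrangement from which [lcs_trails]
    starts. *)
Lemma frog_speeds : exists (s a : 'I_k -> R) (C : R),
  [/\ forall m, 0 <= a m /\ ((1 < #|Sigma|)%N -> a m != 0),
      forall F m n, `|word_mean n (path_sum move (disp m) F) - s m * n%:R| <= C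
    & forall rho m, exists C', forall n, (0 < n)%N ->
       `|word_mean n (fun w => Num.max (rho * n%:R - path_sum move (disp m) 1%g w) 0) -
         ((if s m <= rho then rho - s m else 0) * n%:R +
          (if s m == rho then a m / 2 else 0) * Num.sqrt n%:R)| <= C'].
Proof.
have [w0 sync] := synchronizing_word k0 irr.
have af m : exists p : R * R * R, [/\ 0 <= p.1.2 /\ ((1 < #|Sigma|)%N -> p.1.2 != 0),
    0 <= p.2, forall F n, `|word_mean n (path_sum move (disp m) F) - p.1.1 * n%:R| <= p.2
    & forall rho, exists C', forall n, (0 < n)%N ->
       `|word_mean n (fun w => Num.max (rho * n%:R - path_sum move (disp m) 1%g w) 0) -
         ((if p.1.1 <= rho then rho - p.1.1 else 0) * n%:R +
          (if p.1.1 == rho then p.1.2 / 2 else 0) * Num.sqrt n%:R)| <= C'].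
  have [s [a [C [a0 [C0 mean] var abs coboundary]]]] :=
    additive_functional c0 sync (disp m).
  exists (s, a, C); split=> //=.
    split=> // Sigma2; apply/eqP => /coboundary[u /(displacement_not_coboundary Sigma2)] //.
  move=> rho; exact: (mean_positive_part c0 C0 (mean 1%g) var abs).
have [p pP] := fin_all_exists af.
exists (fun m => (p m).1.1), (fun m => (p m).1.2), (\sum_m (p m).2); split.
- by move=> m; case: (pP m).
- move=> F m n; case: (pP m) => _ _ /(_ F n) h _; apply: le_trans h _.
  rewrite (bigD1 m) //= lerDl sumr_ge0 // => j _; by case: (pP j).
- by move=> rho m; case: (pP m).
Qed.

End FrogAsymptotics.

Theorem theorem2 (R : realType) (Sigma : finType) (k : nat) (hk : (0 < k)%N)
    (W : k.-tuple Sigma) (hW : ~ reducible_word W) :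
  (exists! pi : {ffun arrangement k -> R}, frog_stationary W pi) /\
  exists s : 'I_k -> R,
    (forall (F0 : arrangement k) (m : 'I_k),
       expected_displacement R W F0 m n / n%:R @[n --> \oo] --> s m) /\
    (forall rho : R, 0 <= rho ->
       (exists gamma tau : R, lcs_constants W rho gamma tau) /\
       (forall gamma tau : R, lcs_constants W rho gamma tau ->
          gamma = rho - k%:R^-1 * \sum_(m < k | s m <= rho) (rho - s m) /\
          ((1 < #|Sigma|)%N -> (tau <> 0 <-> exists m : 'I_k, rho = s m)))).
Proof.
split; first exact: frog_stationary_unique.
have [s [a [C [a_prop mean pospart]]]] := frog_speeds R hk hW.
exists s; split.
  move=> F0 m; apply: (@cvg_of_bounded_error _ _ _ C) => n.
  by rewrite expected_displacementE; apply: mean.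
move=> rho rho0.
pose gamma := rho - k%:R^-1 * \sum_(m < k | s m <= rho) (rho - s m).
(* Only frogs with speed exactly [rho] contribute at order [sqrt n], each with the [a m / 2] of
   [mean_positive_part]. *)
pose tau := k%:R^-1 * \sum_(m < k | s m == rho) a m / 2.
have constants : lcs_constants W rho gamma tau.
  have [C' C'P] := fin_all_exists (pospart rho).
  exists (1 + 3 * k%:R + k%:R^-1 * \sum_m C' m); near=> n.
  have n0 : (0 < n)%N by near: n; exact: nbhs_infty_gt.
  rewrite /expected_lcs (expect_tuple n (fun w =>
    (lcs w (periodic_word W (Num.truncn (rho * n%:R))))%:R : R)).
  set L := word_mean n _.
  pose M := word_mean n (fun w => rho * n%:R - k%:R^-1 * \sum_(m < k)
    Num.max (rho * n%:R - path_sum (frog_move W) (fun F c => (displacement1 W F c m)%:R) 1%g w) 0).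
  have LM : `|L - M| <= 1 + 3 * k%:R.
    apply: (word_mean_near (tnth W (pad hk 0))) => w _; exact: lcs_positive_parts.
  have -> : L - (gamma * n%:R - tau * Num.sqrt n%:R) = (L - M) +
      (M - (gamma * n%:R - tau * Num.sqrt n%:R)) by ring.
  apply: le_trans (ler_normD _ _) _; apply: lerD LM _.
  have -> : M - (gamma * n%:R - tau * Num.sqrt n%:R) = - (k%:R^-1 * \sum_(m < k)
      (word_mean n (fun w => Num.max (rho * n%:R - path_sum (frog_move W)
         (fun F c => (displacement1 W F c m)%:R) 1%g w) 0) -
       ((if s m <= rho then rho - s m else 0) * n%:R +
          (if s m == rho then a m / 2 else 0) * Num.sqrt n%:R))).
    rewrite /M word_meanB (word_mean_cst (tnth W (pad hk 0))) word_meanZ word_mean_sum.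
    rewrite sumrB big_split /= -!mulr_suml -!big_mkcond /= /gamma /tau; ring.
  rewrite normrN normrM ger0_norm ?invr_ge0 // ler_wpM2l ?invr_ge0 //.
  by apply: le_trans (ler_norm_sum _ _ _) _; apply: ler_sum => m _; apply: C'P.
split; first by exists gamma, tau.
move=> gamma' tau' [C1 C1P]; have [C2 C2P] := constants.
have [|eg et] := @bounded_linear_sqrt R (gamma - gamma') (tau - tau') (C1 + C2).
  near=> n.
  have : `|expected_lcs W rho n - (gamma' * n%:R - tau' * Num.sqrt n%:R)| <= C1.
    by near: n.
  have : `|expected_lcs W rho n - (gamma * n%:R - tau * Num.sqrt n%:R)| <= C2.
    by near: n.
  by rewrite !ler_norml => /andP[? ?] /andP[? ?]; apply/andP; split; lra.
have -> : gamma' = gamma by apply/eqP; rewrite eq_sym -subr_eq0 eg.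
have -> : tau' = tau by apply/eqP; rewrite eq_sym -subr_eq0 et.
split=> // Sigma2; have kR : 0 < k%:R^-1 :> R by rewrite invr_gt0 ltr0n.
split=> [tau0|[m rhom]].
  have [/existsP[m /eqP sm]|] := boolP [exists m, s m == rho]; first by exists m.
  move=> /existsPn none; exfalso; apply: tau0.
  by rewrite /tau big_pred0 ?mulr0 // => m; apply/negbTE.
apply/eqP; rewrite gt_eqF // mulr_gt0 // (bigD1 m) /=; last by rewrite rhom.
have am i : 0 < a i by have [? /(_ Sigma2) ?] := a_prop i; rewrite lt_neqAle eq_sym; apply/andP.
by rewrite ltr_pwDl ?divr_gt0 // sumr_ge0 // => i _; rewrite divr_ge0 // ltW.
Unshelve. all: by end_near. Qed.
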